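(* Let $\{r_i\}_{i=1}^\infty$ be the sequence of all rational numbers in lowest terms in $(0,1)$, ordered first by increasing denominator and then by increasing numerator, and let $\mathbb{P}$ be the set of primes. Let $R$ be one of the following subsequences of $\{r_i\}$ (numerators and denominators taken in lowest terms): (1) those whose numerator is in $\mathbb{N}$ and whose denominator is in $\mathbb{P}$; (2) those whose numerator is in $\mathbb{P}$ and whose denominator is in $\mathbb{N}$; (3) those whose numerator and denominator are both in $\mathbb{P}$. If the indices of the $r_i\in R$ are, in increasing order, $i_1<i_2<i_3<\cdots$, then the number whose continued fraction expansion is obtained by concatenating, in order, the finite continued fraction expansions of $r_{i_1},r_{i_2},r_{i_3},\dots$ is CF-normal.
   Context: Every $x\in[0,1)$ has a continued fraction expansion $x=\langle a_1,a_2,\dots\rangle$ with $a_i\in\mathbb{N}$; for rationals, the longer of the two finite expansions (the one ending in the digit $1$) is used. The Gauss measure is $\mu(A)=\frac{1}{\log 2}\int_A \frac{dx}{1+x}$; for a finite string $s=[d_1,\dots,d_k]$ of positive integers, $C_s=\{x\in[0,1):a_i(x)=d_i,\ 1\le i\le k\}$; $A_s(N;x)$ is the number of positions $1\le i\le N$ at which $s$ starts in the continued fraction expansion of $x$. A number is CF-normal if $A_s(N;x)/N\to\mu(C_s)$ for every finite string $s$. *)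

(* Defs.v *)
From HB Require Import structures.
From mathcomp Require Import all_boot all_order all_algebra.
From mathcomp Require Import all_classical all_reals all_analysis.
Set Implicit Arguments. Unset Strict Implicit. Unset Printing Implicit Defensive.
Import Order.TTheory GRing.Theory Num.Theory numFieldNormedType.Exports.
Local Open Scope ring_scope.
Local Open Scope classical_set_scope.

Section CF.
Variable R : realType.

Definition gauss (x : R) : R :=
  if x == 0 then 0 else x^-1 - (Num.truncn x^-1)%:R.

Definition gauss_orbit (x : R) (n : nat) : R := iter n gauss x.

(* i-th continued fraction digit a_i(x) (i >= 1) of x in [0,1), or None if
   the expansion has fewer than i digits.  For rationals the LONGER of the two
   finite expansions (the one ending in 1) is produced: the last Gauss-map
   digit a >= 2 is replaced by the two digits a-1, 1. *)
Definition cf_digit (x : R) (i : nat) : option nat :=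
  match i with
  | 0 => None
  | i'.+1 =>
    let y := gauss_orbit x i' in
    if y != 0 then
      let a := Num.truncn y^-1 in
      if gauss y == 0 then Some a.-1 else Some a
    else match i' with
         | 0 => None
         | i''.+1 => if gauss_orbit x i'' != 0 then Some 1%N else None
         end
  end.

(* the finite CF expansion (longer form) of the rational p/q, 0 < p < q:
   its length is at most q, so reading 2q digits suffices. *)
Definition cf_rat (p q : nat) : seq nat :=
  pmap (cf_digit (p%:R / q%:R)) (iota 1 (2 * q)).

Definition cylinder (s : seq nat) : set R :=
  [set x | 0 <= x < 1 /\
           forall j, (j < size s)%N -> cf_digit x j.+1 = Some (nth 0%N s j)].

Definition gauss_measure (A : set R) : R :=
  (ln 2)^-1 * fine (\int[lebesgue_measure]_(x in A) ((1 + x)^-1)%:E).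

Definition occ (s : seq nat) (N : nat) (x : R) : nat :=
  count (fun i => all (fun j => cf_digit x (i + j) == Some (nth 0%N s j))
                      (iota 0 (size s)))
        (iota 1 N).

Definition cf_normal (x : R) : Prop :=
  forall s : seq nat, all (fun d => 0 < d)%N s ->
    let u : nat -> R := fun N => (occ s N x)%:R / N%:R in
    u @ \oo --> gauss_measure (cylinder s).

Definition has_cf (x : R) (d : nat -> nat) : Prop :=
  0 <= x < 1 /\ forall i, cf_digit x i.+1 = Some (d i).

End CF.

Inductive subseq_kind := NumNat_DenPrime | NumPrime_DenNat | NumPrime_DenPrime.

Definition selR (k : subseq_kind) (p q : nat) : bool :=
  match k with
  | NumNat_DenPrime => prime q
  | NumPrime_DenNat => prime p
  | NumPrime_DenPrime => prime p && prime q
  end.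

Definition concat_prefix (R : realType) (k : subseq_kind) (Q : nat) : seq nat :=
  flatten [seq flatten [seq cf_rat R p q
                       | p <- iota 1 q.-1 & coprime p q && selR k p q]
          | q <- iota 2 Q.-1].

Definition is_concat (R : realType) (k : subseq_kind) (d : nat -> nat) : Prop :=
  forall Q i, (i < size (concat_prefix R k Q))%N ->
    d i = nth 0%N (concat_prefix R k Q) i.

(* Main.v *)
Require Import Defs.
From HB Require Import structures.
From mathcomp Require Import all_boot all_order all_algebra.
From mathcomp Require Import all_classical all_reals all_analysis.
From mathcomp Require Import measurable_realfun ring lra zify.
Set Implicit Arguments. Unset Strict Implicit. Unset Printing Implicit Defensive.
Import Order.TTheory GRing.Theory Num.Theory numFieldNormedType.Exports.
Local Open Scope ring_scope.
Local Open Scope classical_set_scope.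

(** Read backwards, the digits of an expansion form a chain with complete
connections: from the tail [x] the digit [a] is drawn with probability
[(1 + x) / ((a + x) (a + x + 1))] and the tail becomes [1 / (a + x)].  The
product of these weights along the expansion of [p / q] is at least
[1 / (2 q^2)], so the number of words [w] in a bad set whose rational has
denominator at most [Q] is at most [2 Q^2] times the probability of that set.
The transition operator contracts Lipschitz constants by 7/8 and preserves the
Gauss measure, hence the probability of seeing a string [s] after a long gap is
uniformly close to its Gauss measure, and a Chernoff bound along arithmetic
progressions makes the probability of a wrong frequency of [s] exponentially
small in the length.  Words shorter than [ln Q / 8] are few by Rankin's trick,
as [q] is at least the product of the digits.  So all but [o(Q^2 / ln^2 Q)]
rationals have about the right frequency of [s], whereas by Chebyshev's lower
bound already the pairs of primes contribute at least [Q^2 / (144 ln^2 Q)]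
rationals to each of the three sequences.

All sums are truncated to digits at most [M]; this costs errors [O(1 / M)] in
the properties of the operator and avoids infinite sums over digits. *)

Local Notation positive w := (all (fun d => 0 < d)%N w).
Local Notation unit_itv := [set x | 0 <= x <= 1].

(** * Elementary estimates *)

Lemma near_inftyS (P : set nat) :
  (\forall n \near \oo, P n) -> \forall n \near \oo, P n.+1.
Proof. by move=> [N _ NP]; exists N => // n /= Nn; apply: NP; apply: leqW. Qed.

Section Estimates.
Variable R : realType.
Implicit Types x y t : R.

Lemma normr_invB x y : 0 < x -> 0 < y -> `|x^-1 - y^-1| = `|x - y| / (x * y).
Proof.
move=> x0 y0; rewrite (_ : x^-1 - y^-1 = (y - x) / (x * y)); last first.
  by field; rewrite !gt_eqF.
by rewrite normrM distrC [X in _ * X]gtr0_norm // invr_gt0 mulr_gt0.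
Qed.

Lemma sum_inv_cube_le M : \sum_(2 <= m < M.+1) (m%:R ^+ 3)^-1 <= 4^-1 :> R.
Proof.
case: M => [|M]; first by rewrite big_geq // invr_ge0.
suff : \sum_(2 <= m < M.+2) (m%:R ^+ 3)^-1
  <= 4^-1 - (2 * M.+1%:R * M.+2%:R)^-1 :> R.
  by move/le_trans; apply; rewrite gerBl invr_ge0 !mulr_ge0 ?ler0n.
elim: M => [|M IH]; first by rewrite big_geq // subr_ge0 lef_pV2 ?posrE; lra.
rewrite big_nat_recr //=; apply: le_trans (lerD IH (lexx _)) _.
rewrite -[M.+3%:R]natr1; set z : R := M.+2%:R.
have -> : M.+1%:R = z - 1 by rewrite /z -[M.+2%:R]natr1 addrK.
have z2 : 2 <= z by rewrite /z (ler_nat R 2).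
have -> : 4^-1 - (2 * z * (z + 1))^-1 =
    4^-1 - (2 * (z - 1) * z)^-1 + ((z - 1) * z * (z + 1))^-1.
  by field; do ?[apply/andP; split]; lra.
by rewrite lerD2l lef_pV2 ?posrE ?exprn_gt0 ?mulr_gt0 //; lra.
Qed.

Lemma near_geometric_lt (c z e : R) : `|z| < 1 -> 0 < e ->
  \forall n \near \oo, c * z ^+ n < e.
Proof.
move=> z1 e0; have := cvg_geometric c z1 => /cvgr0_norm_lt /(_ _ e0).
by apply: filterS => n; apply: le_lt_trans; apply: ler_norm.
Qed.

Lemma expR_le_quadratic t : `|t| <= 2^-1 -> expR t <= 1 + t + 2 * t ^+ 2.
Proof.
rewrite ler_norml => /andP[t1 t2].
have t3 : 0 < 1 - t by lra.
have le_expRN : 1 - t <= expR (- t) by apply: expR_ge1Dx.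
rewrite -[t in expR t]opprK expRN.
apply: (@le_trans _ _ (1 - t)^-1).
  by rewrite lef_pV2 ?posrE // (lt_le_trans t3 le_expRN).
by rewrite -[leLHS]mul1r ler_pdivrMr //; nra.
Qed.

Lemma normr_expR_sub1_le t : `|t| <= 2^-1 -> `|expR t - 1| <= 2 * `|t|.
Proof.
move=> t2; have := expR_le_quadratic t2; have := expR_ge1Dx t.
move: t2; rewrite !ler_norml => /andP[? ?] ? ?.
have [t0|t0] := leP 0 t.
  by rewrite ger0_norm //; apply/andP; split; nra.
by rewrite ltr0_norm //; apply/andP; split; nra.
Qed.

Lemma bernoulli_mgf_le t (m P e : R) : `|t| <= 2^-1 -> 0 <= m <= 1 ->
  `|P - m| <= e ->
  1 + (expR t - 1) * P <= expR (t * m + 2 * t ^+ 2 + 2 * `|t| * e).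
Proof.
move=> t2 /andP[m0 m1] Pm; apply: le_trans (expR_ge1Dx _); rewrite lerD2l.
have P_to_m : (expR t - 1) * P <= (expR t - 1) * m + 2 * `|t| * e.
  rewrite -lerBlDl -mulrBr; apply: le_trans (ler_norm _) _; rewrite normrM.
  by apply: ler_pM => //; apply: normr_expR_sub1_le.
apply: le_trans P_to_m _; rewrite lerD2r.
apply: (@le_trans _ _ ((t + 2 * t ^+ 2) * m)).
  by rewrite ler_wpM2r //; have := expR_le_quadratic t2; lra.
by rewrite mulrDl lerD2l ler_piMr // mulr_ge0 // sqr_ge0.
Qed.

Lemma expR_mean_le b (Y : nat -> R) : (0 < b)%N ->
  b%:R * expR ((\sum_(0 <= r < b) Y r) / b%:R) <= \sum_(0 <= r < b) expR (Y r).
Proof.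
move=> b0; have b_neq0 : b%:R != 0 :> R by rewrite pnatr_eq0 -lt0n.
set z := _ / b%:R.
have tangent r : expR z * (1 + (Y r - z)) <= expR (Y r).
  by rewrite -[Y r in leRHS](subrK z) expRD [leRHS]mulrC ler_wpM2l ?expR_ge0
    ?expR_ge1Dx.
apply: le_trans (ler_sum _ (fun r _ => tangent r)).
rewrite -big_distrr big_split /= sumrB !sumr_const_nat subn0 mulrC.
by rewrite ler_wpM2l ?expR_ge0 // -[z *+ b]mulr_natr /z divfK // subrr addr0.
Qed.

Lemma expRN_le_invX4 x : 0 < x -> expR (- x) <= 24 / x ^+ 4.
Proof.
move=> x0; have := expR_ge1Dxn 3 (ltW x0); rewrite -[4`!]/24%N => taylor.
rewrite expRN -[24 / _]invf_div lef_pV2 ?posrE ?expR_gt0 ?divr_gt0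
  ?exprn_gt0 //.
by apply: le_trans taylor; rewrite lerDr.
Qed.

Lemma natr_count_le_sum (I : eqType) (r : seq I) (P : pred I) (F : I -> R) :
  {in r, forall i, (P i)%:R <= F i} -> (count P r)%:R <= \sum_(i <- r) F i.
Proof.
move=> PF; rewrite -sum1_count natr_sum big_mkcond big_seq [leRHS]big_seq.
by apply: ler_sum => i /PF; case: (P i).
Qed.

Lemma ln2_ge_half : 2^-1 <= ln 2 :> R.
Proof.
have : ln (1 + (- 2^-1)) <= - 2^-1 :> R by apply: le_ln1Dx; lra.
have -> : 1 + (- 2^-1) = 2^-1 :> R by field.
by rewrite lnV ?posrE // lerN2.
Qed.

Lemma ln2_gt0 : 0 < ln 2 :> R.
Proof. by rewrite ln_gt0 ?ltr1n. Qed.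

Lemma sqr_ln_le x : 1 <= x -> ln x ^+ 2 <= 2 * x.
Proof.
move=> x1; have := expR_ge1Dxn 1 (ln_ge0 x1).
by rewrite lnK ?posrE -?[2`!]/2%N; lra.
Qed.

Lemma near_ln_ge (A : R) : \forall n \near \oo, A <= ln n%:R.
Proof.
near=> n; have An : expR A <= n%:R by near: n; exact: nbhs_infty_ger.
by rewrite -[A]expRK ler_ln ?posrE ?(lt_le_trans _ An) ?expR_gt0.
Unshelve. all: by end_near. Qed.

Lemma ler_sum_orb (I : eqType) (r : seq I) (P P1 P2 : pred I) (F : I -> R) :
  {in r, forall i, 0 <= F i} -> {in r, forall i, P i -> P1 i || P2 i} ->
  \sum_(i <- r | P i) F i <=
    \sum_(i <- r | P1 i) F i + \sum_(i <- r | P2 i) F i.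
Proof.
move=> F0 P12; rewrite !(big_mkcond P) !(big_mkcond P1) !(big_mkcond P2) /=.
rewrite -big_split /= big_seq [leRHS]big_seq; apply: ler_sum => i ir.
have := F0 i ir; have := P12 i ir.
by case: (P i); case: (P1 i); case: (P2 i) => /=; lra.
Qed.

Lemma sum_nat_blocks (V : zmodType) (c : nat -> V) b J :
  \sum_(0 <= i < J * b) c i =
  \sum_(0 <= r < b) \sum_(0 <= j < J) c (r + j * b)%N.
Proof.
rewrite exchange_big_nat /=; elim: J => [|J IH];
  first by rewrite mul0n !big_geq.
rewrite big_nat_recr //= -IH mulSn addnC (big_cat_nat _ (leq_addr b (J * b)))
  //=.
congr (_ + _); rewrite -{1}[(J * b)%N]add0n big_addn addKn.
by apply: eq_bigr.
Qed.

Lemma is_derive_addl (c x : R) : is_derive x 1 (fun y : R => c + y) 1.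
Proof.
by rewrite (_ : (fun y => _) = shift c);
  [exact: is_derive_shift | apply/funext => y /=; rewrite addrC].
Qed.

Lemma is_derive_ln1D x : -1 < x ->
  is_derive x 1 (fun y : R => ln (1 + y)) (1 + x)^-1.
Proof.
move=> x1; have dln : is_derive (1 + x) 1 (@ln R) (1 + x)^-1.
  by apply: is_derive1_ln; lra.
by have := is_derive1_comp dln (is_derive_addl 1 x); rewrite mulr1.
Qed.

End Estimates.

(** * The Gauss-Kuzmin operator *)

Section DigitWeights.
Variable R : realType.
Implicit Types (x y : R) (a m M : nat) (w s : seq nat).

Definition cf_eval w x : R := foldr (fun a y => (a%:R + y)^-1) x w.

(* At [x = 0] this is the reciprocal of the denominator of the convergent. *)
Definition cf_tails w x : R := \prod_(i < size w) cf_eval (drop i w) x.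

Definition digit_weight a x : R := (1 + x) / ((a%:R + x) * (a%:R + x + 1)).

Fixpoint word_weight w x : R :=
  if w is a :: w' then digit_weight a (cf_eval w' x) * word_weight w' x else 1.

(* The total weight of the digits [>= m]. *)
Definition digit_tail m x : R := (1 + x) / (m%:R + x).

Lemma inv_digit_itv a x : (0 < a)%N -> 0 <= x <= 1 -> 0 <= (a%:R + x)^-1 <= 1.
Proof.
rewrite -(ler1n R) => a1 /andP[x0 x1].
rewrite invr_ge0 invf_le1; last by lra.
by apply/andP; split; lra.
Qed.

Lemma normr_inv_digitB_le a x y : (0 < a)%N -> 0 <= x -> 0 <= y ->
  `|(a%:R + x)^-1 - (a%:R + y)^-1| <= `|x - y| / a%:R ^+ 2.
Proof.
rewrite -(ler1n R) => a1 x0 y0; rewrite normr_invB; [|lra|lra].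
rewrite (_ : a%:R + x - (a%:R + y) = x - y); last by ring.
by rewrite ler_wpM2l // lef_pV2 ?posrE ?exprn_gt0 ?mulr_gt0 //; nra.
Qed.

Lemma cf_eval_itv w x : positive w -> 0 <= x <= 1 -> 0 <= cf_eval w x <= 1.
Proof.
elim: w => //= a w IH /andP[a0 w0] x01.
by apply: inv_digit_itv => //; apply: IH.
Qed.

Lemma cf_eval_cat w1 w2 x : cf_eval (w1 ++ w2) x = cf_eval w1 (cf_eval w2 x).
Proof. exact: foldr_cat. Qed.

Lemma cf_eval_rcons s a x : cf_eval (rcons s a) x = cf_eval s (a%:R + x)^-1.
Proof. by rewrite -cats1 cf_eval_cat. Qed.

Lemma word_weight_cat w1 w2 x :
  word_weight (w1 ++ w2) x = word_weight w1 (cf_eval w2 x) * word_weight w2 x.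
Proof.
elim: w1 => [|a w1 IH] /=; first by rewrite mul1r.
by rewrite IH cf_eval_cat mulrA.
Qed.

Lemma word_weight_rcons s a x :
  word_weight (rcons s a) x = digit_weight a x * word_weight s (a%:R + x)^-1.
Proof. by rewrite -cats1 word_weight_cat /= mulr1 mulrC. Qed.

Lemma digit_weight_ge0 a x : 0 <= x -> 0 <= digit_weight a x.
Proof. by move=> x0; rewrite divr_ge0 ?mulr_ge0 ?addr_ge0. Qed.

Lemma digit_weight_le1 a x : (0 < a)%N -> 0 <= x <= 1 -> digit_weight a x <= 1.
Proof.
rewrite -(ler1n R) => a1 /andP[x0 x1]; rewrite /digit_weight ler_pdivrMr; nra.
Qed.

Lemma word_weight_ge0 w x : positive w -> 0 <= x <= 1 -> 0 <= word_weight w x.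
Proof.
elim: w => //= a w IH /andP[a0 w0] x01.
by rewrite mulr_ge0 ?IH // digit_weight_ge0 //; case/andP: (cf_eval_itv w0 x01).
Qed.

Lemma word_weight_le1 s x : positive s -> 0 <= x <= 1 -> word_weight s x <= 1.
Proof.
elim: s => //= a s IH /andP[a0 s0] x01; have e01 := cf_eval_itv s0 x01.
rewrite mulr_ile1 ?IH ?word_weight_ge0 ?digit_weight_le1 //.
by apply: digit_weight_ge0; case/andP: e01.
Qed.

Lemma digit_weightE a x : (0 < a)%N -> 0 <= x ->
  digit_weight a x = digit_tail a x - digit_tail a.+1 x.
Proof.
rewrite -(ler1n R) => a1 x0; rewrite /digit_weight /digit_tail -natr1.
by field; apply/andP; split; lra.
Qed.

Lemma digit_tail1 x : 0 <= x -> digit_tail 1 x = 1.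
Proof. by move=> x0; rewrite /digit_tail divff //; lra. Qed.

Lemma digit_tail_ge0 m x : 0 <= x -> 0 <= digit_tail m x.
Proof. by move=> x0; rewrite divr_ge0 ?addr_ge0. Qed.

Lemma normr_digit_tailB_le m x y : 0 <= x -> 0 <= y ->
  `|digit_tail m.+1 y - digit_tail m.+1 x| <= m%:R / m.+1%:R ^+ 2 * `|y - x|.
Proof.
move=> x0 y0; have m0 : 0 <= m%:R :> R by [].
rewrite /digit_tail -[m.+1%:R]natr1 (_ : _ - _ =
    m%:R / ((m%:R + 1 + x) * (m%:R + 1 + y)) * (y - x)); last first.
  by field; apply/andP; split; lra.
rewrite normrM ler_wpM2r // ger0_norm;
  last by rewrite divr_ge0 ?mulr_ge0 //; lra.
by rewrite ler_wpM2l // lef_pV2 ?posrE ?exprn_gt0 ?mulr_gt0 //; nra.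
Qed.

Lemma sum_digit_weight m M x : (0 < m)%N -> (m <= M.+1)%N -> 0 <= x ->
  \sum_(m <= a < M.+1) digit_weight a x = digit_tail m x - digit_tail M.+1 x.
Proof.
move=> m0 mM x0.
under eq_big_nat => a /andP[ma _] do
  rewrite digit_weightE ?(leq_trans m0 ma) // -[_ - _]opprB.
by rewrite sumrN telescope_sumr // opprB.
Qed.

Lemma sum_digit_weight_le m M x : (0 < m)%N -> 0 <= x ->
  \sum_(m <= a < M.+1) digit_weight a x <= digit_tail m x.
Proof.
move=> m0 x0; have [mM|Mm] := leqP m M.+1.
  by rewrite sum_digit_weight // gerBl digit_tail_ge0.
by rewrite big_geq ?digit_tail_ge0 // ltnW.
Qed.

End DigitWeights.

Section GaussKuzminOperator.
Variable R : realType.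
Implicit Types (x y : R) (a m M n : nat) (f : R -> R) (w s : seq nat).

Definition gk_op M f x : R :=
  \sum_(1 <= a < M.+1) digit_weight a x * f (a%:R + x)^-1.

Lemma normr_gk_op_le M f x (B : R) : 0 <= x <= 1 -> 0 <= B ->
  (forall y, 0 <= y <= 1 -> `|f y| <= B) -> `|gk_op M f x| <= B.
Proof.
move=> x01 B0 fB; have /andP[x0 x1] := x01.
apply: le_trans (ler_norm_sum _ _ _) _.
apply: (@le_trans _ _ (\sum_(1 <= a < M.+1) digit_weight a x * B)).
  apply: ler_sum_nat => a /andP[a0 _].
  rewrite normrM ger0_norm ?digit_weight_ge0 // ler_wpM2l ?digit_weight_ge0 //.
  by apply: fB; apply: inv_digit_itv.
rewrite -big_distrl /= -[leRHS]mul1r ler_wpM2r // -(digit_tail1 x0).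
exact: sum_digit_weight_le.
Qed.

Lemma normr_iter_gk_op_le M f (B : R) n : 0 <= B ->
  (forall y, 0 <= y <= 1 -> `|f y| <= B) ->
  forall x, 0 <= x <= 1 -> `|iter n (gk_op M) f x| <= B.
Proof.
move=> B0 fB; elim: n => [|n IH] x x01 /=; first exact: fB.
exact: normr_gk_op_le.
Qed.

Lemma abel_sum_digits (D g : nat -> R) M :
  \sum_(1 <= a < M.+2) (D a - D a.+1) * g a =
  D 1%N * g 1%N + \sum_(2 <= m < M.+2) D m * (g m - g m.-1) - D M.+2 * g M.+1.
Proof.
elim: M => [|M IH]; first by rewrite big_nat1 big_geq //; ring.
by rewrite big_nat_recr //= IH [in RHS]big_nat_recr //=; ring.
Qed.

(* Summation by parts couples the digit drawn from [x] with the one drawn from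
   [y]: the first sum moves the tail under a fixed digit and contracts by 5/8,
   the second changes the digit and contracts by 1/4. *)
Lemma gk_opB_abel M f x y : 0 <= x -> 0 <= y ->
  let D m := digit_tail m y - digit_tail m x in
  let g m := f (m%:R + x)^-1 in
  gk_op M.+1 f y - gk_op M.+1 f x =
    \sum_(1 <= a < M.+2) digit_weight a y * (f (a%:R + y)^-1 - g a)
    + \sum_(2 <= m < M.+2) D m * (g m - g m.-1) - D M.+2 * g M.+1.
Proof.
move=> x0 y0 D g; have := abel_sum_digits D g M.
rewrite [D 1%N]/D !digit_tail1 // subrr mul0r add0r -addrA => <-.
rewrite /gk_op -sumrB -big_split /=; apply: eq_big_nat => a /andP[a0 _].
by rewrite !digit_weightE // /D /g; ring.
Qed.

Lemma lipschitz_inv_digit_le f (c : R) a x y :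
  0 <= c -> c.-lipschitz_unit_itv f -> (0 < a)%N ->
  0 <= x <= 1 -> 0 <= y <= 1 ->
  `|f (a%:R + y)^-1 - f (a%:R + x)^-1| <= c * (`|y - x| / a%:R ^+ 2).
Proof.
move=> c0 fc a0 x01 y01.
apply: le_trans
  (fc (_, _) (conj (inv_digit_itv a0 y01) (inv_digit_itv a0 x01))) _.
rewrite ler_wpM2l // normr_inv_digitB_le //;
  [by case/andP: y01 | by case/andP: x01].
Qed.

(* [5/8 = 1/2 + 1/2 * 1/4]: the digit 1 has weight at most 1/2, and the inverse
   branch of any larger digit contracts by 1/4. *)
Lemma sum_branches_le M f (c : R) x y : 0 <= c -> c.-lipschitz_unit_itv f ->
  0 <= x <= 1 -> 0 <= y <= 1 ->
  `|\sum_(1 <= a < M.+2) digit_weight a y * (f (a%:R + y)^-1 - f (a%:R + x)^-1)|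
  <= 5/8 * c * `|y - x|.
Proof.
move=> c0 fc x01 y01; have /andP[y0 y1] := y01.
set cd := c * `|y - x|; have cd0 : 0 <= cd by rewrite mulr_ge0.
have branch a : (0 < a)%N ->
  `|f (a%:R + y)^-1 - f (a%:R + x)^-1| <= cd / a%:R ^+ 2.
  by move=> a0; rewrite -mulrA; apply: lipschitz_inv_digit_le.
have weight1 : 0 <= digit_weight 1 y <= 2^-1.
  rewrite digit_weight_ge0 //= /digit_weight ler_pdivrMr; nra.
rewrite big_nat_recl //; apply: le_trans (ler_normD _ _) _.
apply: (@le_trans _ _
    (digit_weight 1 y * cd + (1 - digit_weight 1 y) * (cd / 4)));
  last by rewrite -mulrA -/cd; have /andP[_ ?] := weight1; nra.
apply: lerD.
  rewrite normrM ger0_norm; last by case/andP: weight1.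
  rewrite ler_wpM2l //; first by case/andP: weight1.
  by apply: le_trans (branch 1%N isT) _; rewrite expr1n divr1.
apply: (@le_trans _ _ ((\sum_(2 <= a < M.+2) digit_weight a y) * (cd / 4))).
  apply: le_trans (ler_norm_sum _ _ _) _; rewrite big_distrl /= [leRHS]big_add1.
  apply: ler_sum_nat => a /andP[a0 _].
  rewrite normrM ger0_norm ?digit_weight_ge0 // ler_wpM2l ?digit_weight_ge0 //.
  apply: le_trans (branch a.+1 isT) _.
  rewrite ler_wpM2l // lef_pV2 ?posrE ?exprn_gt0 //.
  have a2 : 2 <= a.+1%:R :> R by rewrite (ler_nat R 2).
  nra.
rewrite ler_wpM2r ?mulr_ge0 // digit_weightE // digit_tail1 //
  opprB addrC subrK.
exact: sum_digit_weight_le.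
Qed.

Lemma sum_digit_change_le M f (c : R) x y : 0 <= c -> c.-lipschitz_unit_itv f ->
  0 <= x <= 1 -> 0 <= y <= 1 ->
  `|\sum_(2 <= m < M.+1) (digit_tail m y - digit_tail m x) *
      (f (m%:R + x)^-1 - f (m.-1%:R + x)^-1)| <= 4^-1 * c * `|y - x|.
Proof.
move=> c0 fc x01 y01; have /andP[x0 _] := x01; have /andP[y0 _] := y01.
have cd0 : 0 <= c * `|y - x| by rewrite mulr_ge0.
apply: le_trans (ler_norm_sum _ _ _) _; rewrite -mulrA mulrC.
apply: le_trans (ler_wpM2l cd0 (sum_inv_cube_le R M)).
rewrite big_distrr /=; apply: ler_sum_nat => -[|[|m]] // _; rewrite normrM /=.
have m1 : 1 <= m.+1%:R :> R by rewrite ler1n.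
have jump : `|f (m.+2%:R + x)^-1 - f (m.+1%:R + x)^-1|
  <= c / (m.+2%:R * m.+1%:R).
  have itv i : 0 <= (i.+1%:R + x)^-1 <= 1 by apply: inv_digit_itv.
  apply: le_trans (fc (_, _) (conj (itv m.+1) (itv m))) _.
  rewrite ler_wpM2l // normr_invB; [|lra|lra].
  rewrite -[m.+2%:R]natr1 (_ : _ - _ = 1); last by ring.
  by rewrite normr1 mul1r lef_pV2 ?posrE ?mulr_gt0 //; nra.
apply: le_trans (ler_pM _ _ (normr_digit_tailB_le m.+1 x0 y0) jump) _ => //.
rewrite le_eqVlt; apply/orP; left; apply/eqP.
by field; apply/andP; split; lra.
Qed.

Lemma gk_op_lipschitz M f (c B : R) : 0 <= c -> c.-lipschitz_unit_itv f ->
  (forall x, 0 <= x <= 1 -> `|f x| <= B) ->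
  (7/8 * c + B / M.+1%:R).-lipschitz_unit_itv (gk_op M f).
Proof.
move=> c0 fc fB [y x] /= [y01 x01].
have /andP[x0 _] := x01; have /andP[y0 _] := y01.
have B0 : 0 <= B by apply: le_trans (normr_ge0 (f x)) (fB x x01).
case: M => [|M].
  by rewrite /gk_op !big_geq // subrr normr0 !(mulr_ge0, addr_ge0, divr_ge0).
rewrite gk_opB_abel // [leRHS](_ : _ =
    5/8 * c * `|y - x| + 4^-1 * c * `|y - x| + B / M.+2%:R * `|y - x|);
  last first.
  by rewrite (_ : 7/8 = 5/8 + 4^-1); [ring | field].
apply: le_trans (ler_normB _ _) _; apply: lerD.
  apply: le_trans (ler_normD _ _) _; apply: lerD; first exact: sum_branches_le.
  exact: sum_digit_change_le.
rewrite normrM mulrC -mulrA; apply: ler_pM => //.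
  by apply: fB; apply: inv_digit_itv.
apply: le_trans (normr_digit_tailB_le _ x0 y0) _; rewrite ler_wpM2r //.
by rewrite ler_pdivrMr ?exprn_gt0 // expr2 mulKf ?pnatr_eq0 // ler_nat.
Qed.

Lemma iter_gk_op_lipschitz M f (c B : R) n : 0 <= c ->
  c.-lipschitz_unit_itv f ->
  (forall x, 0 <= x <= 1 -> `|f x| <= B) ->
  ((7/8) ^+ n * c + 8 * B / M.+1%:R).-lipschitz_unit_itv (iter n (gk_op M) f).
Proof.
move=> c0 fc fB.
have B0 : 0 <= B.
  by apply: le_trans (normr_ge0 (f 0)) (fB 0 _); rewrite lexx ler01.
have BM : 0 <= B / M.+1%:R by rewrite divr_ge0.
elim: n => [|n IH].
  move=> xy xyI /=; apply: le_trans (fc xy xyI) _.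
  by rewrite ler_wpM2r // expr0 mul1r lerDl -mulrA mulr_ge0.
have cn0 : 0 <= (7/8) ^+ n * c + 8 * B / M.+1%:R.
  by rewrite addr_ge0 ?mulr_ge0 ?exprn_ge0 //; lra.
have := gk_op_lipschitz M cn0 IH (normr_iter_gk_op_le M n B0 fB).
rewrite (_ : 7/8 * _ + _ = (7/8) ^+ n.+1 * c + 8 * B / M.+1%:R) //.
by rewrite exprS; field.
Qed.

End GaussKuzminOperator.

(** * Equidistribution *)

Section GaussPrimitive.
Variable R : realType.
Implicit Types (x y : R) (F G f g : R -> R) (s : seq nat).

(* The domain extends below 0 so that one-sided derivatives never occur. *)
Definition gauss_primitive F f :=
  forall x, - 2^-1 < x -> is_derive x 1 F (f x / (1 + x)).

Lemma gauss_primitive_ln1D : gauss_primitive (fun x => ln (1 + x)) (fun=> 1).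
Proof. by move=> x x0; rewrite mul1r; apply: is_derive_ln1D; lra. Qed.

Lemma gauss_primitiveN F f : gauss_primitive F f ->
  gauss_primitive (fun x => - F x) (fun x => - f x).
Proof. by move=> Ff x x0; rewrite mulNr; apply: is_deriveN; apply: Ff. Qed.

Lemma gauss_primitiveD F f G g : gauss_primitive F f -> gauss_primitive G g ->
  gauss_primitive (fun x => F x + G x) (fun x => f x + g x).
Proof.
move=> Ff Gg x x0; rewrite mulrDl.
by apply: is_deriveD; [exact: Ff | exact: Gg].
Qed.

Lemma gauss_primitiveZ F f (c : R) : gauss_primitive F f ->
  gauss_primitive (fun x => c * F x) (fun x => c * f x).
Proof. by move=> Ff x x0; rewrite -mulrA; apply: (is_deriveZ c); apply: Ff. Qed.

Lemma gauss_primitive_ndecr F f (a b : R) : gauss_primitive F f ->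
  (forall x, 0 <= x <= 1 -> 0 <= f x) -> 0 <= a -> a <= b -> b <= 1 ->
  F a <= F b.
Proof.
move=> Ff f0 a0 ab b1.
have dF x : 0 <= x -> is_derive x 1 F (f x / (1 + x)).
  by move=> x0; apply: Ff; lra.
apply: (@ger0_derive1_ndecr _ F 0 1) => // [x|x|].
- rewrite in_itv /= => /andP[/ltW x0 _].
  exact: (@ex_derive _ _ _ _ _ _ _ (dF x x0)).
- rewrite in_itv /= derive1E => /andP[/ltW x0 /ltW x1].
  rewrite (derive_val (is_derive := dF x x0)).
  by rewrite divr_ge0 ?f0 ?x0 // addr_ge0.
- apply: derivable_within_continuous => x; rewrite in_itv /= => /andP[x0 _].
  exact: (@ex_derive _ _ _ _ _ _ _ (dF x x0)).
Qed.

Lemma gauss_primitive_near F f (v d a b : R) : gauss_primitive F f ->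
  (forall x, 0 <= x <= 1 -> `|f x - v| <= d) -> 0 <= a -> a <= b -> b <= 1 ->
  `|F b - F a - v * (ln (1 + b) - ln (1 + a))| <= d * (ln (1 + b) - ln (1 + a)).
Proof.
move=> Ff fv a0 ab b1.
have line c := gauss_primitiveZ c gauss_primitive_ln1D.
have upper := gauss_primitiveD (line (v + d)) (gauss_primitiveN Ff).
have lower := gauss_primitiveD Ff (line (d - v)).
have upper_ge0 x : 0 <= x <= 1 -> 0 <= (v + d) * 1 + - f x.
  by move=> /fv; rewrite ler_norml => /andP[]; lra.
have lower_ge0 x : 0 <= x <= 1 -> 0 <= f x + (d - v) * 1.
  by move=> /fv; rewrite ler_norml => /andP[]; lra.
have := gauss_primitive_ndecr upper upper_ge0 a0 ab b1.
have := gauss_primitive_ndecr lower lower_ge0 a0 ab b1.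
by move=> ? ?; rewrite ler_norml; apply/andP; split; lra.
Qed.

Lemma gauss_primitive_digit F f a : (0 < a)%N -> gauss_primitive F f ->
  gauss_primitive (fun x => - F (a%:R + x)^-1)
                  (fun x => digit_weight a x * f (a%:R + x)^-1).
Proof.
rewrite -(ler1n R) => a1 Ff x x0.
have ax : a%:R + x != 0 by lra.
have Vax0 : - 2^-1 < (a%:R + x)^-1.
  by apply: (@lt_trans _ _ 0); [lra | rewrite invr_gt0; lra].
have dVax := is_deriveV ax (is_derive_addl a%:R x).
have := is_deriveN
  (@is_derive1_comp R F (fun y => (a%:R + y)^-1) x _ _ (Ff _ Vax0) dVax).
rewrite (_ : digit_weight a x * _ / _ =
  - (f (a%:R + x)^-1 / (1 + (a%:R + x)^-1) * (- (a%:R + x) ^- 2 *: 1))) //.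
rewrite /digit_weight /GRing.scale /= mulr1; field.
by do ?[apply/andP; split]; lra.
Qed.

Lemma gauss_primitive_gk_op M F f : gauss_primitive F f ->
  gauss_primitive (fun x => - \sum_(1 <= a < M.+1) F (a%:R + x)^-1) (gk_op M f).
Proof.
move=> Ff; elim: M => [|M IH] x x0.
  rewrite /gk_op big_geq // mul0r.
  rewrite (_ : (fun y => _) = cst 0); first exact: is_derive_cst.
  by apply/funext => y; rewrite big_geq // oppr0.
rewrite /gk_op big_nat_recr //= mulrDl.
rewrite (_ : (fun y => _) = (fun y => - \sum_(1 <= a < M.+1) F (a%:R + y)^-1)
   + (fun y => - F (M.+1%:R + y)^-1)).
  by apply: is_deriveD; [exact: IH | exact: gauss_primitive_digit].
by apply/funext => y; rewrite big_nat_recr //= opprD.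
Qed.

Lemma sumB_inverse_branches M F :
  - \sum_(1 <= a < M.+1) F (a%:R + 1)^-1 -
    (- \sum_(1 <= a < M.+1) F (a%:R + 0)^-1) = F 1 - F M.+1%:R^-1.
Proof.
rewrite opprK addrC -sumrB.
under eq_bigr => a _ do rewrite natr1 addr0 -opprB.
by rewrite sumrN telescope_sumr // opprB invr1.
Qed.

(* Without truncation the operator preserves the Gauss measure; each step loses
   only the mass of [0, 1 / (M + 1)]. *)
Lemma gauss_primitive_iter_gk_op M F f (B : R) n : gauss_primitive F f ->
  (forall x, 0 <= x <= 1 -> `|f x| <= B) ->
  exists2 G, gauss_primitive G (iter n (gk_op M) f) &
    `|(G 1 - G 0) - (F 1 - F 0)| <= n%:R * (B / M.+1%:R).
Proof.
move=> Ff fB.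
have B0 : 0 <= B.
  by apply: le_trans (normr_ge0 (f 0)) (fB 0 _); rewrite lexx ler01.
elim: n => [|n [G Gf IH]]; first by exists F => //; rewrite subrr normr0 mul0r.
exists (fun x => - \sum_(1 <= a < M.+1) G (a%:R + x)^-1).
  exact: gauss_primitive_gk_op.
rewrite sumB_inverse_branches.
rewrite (_ : _ - (F 1 - F 0) =
    (G 1 - G 0 - (F 1 - F 0)) - (G M.+1%:R^-1 - G 0)); last by ring.
apply: le_trans (ler_normB _ _) _; rewrite -[n.+1%:R]natr1 mulrDl mul1r lerD //.
have M1 : 0 < M.+1%:R^-1 :> R by rewrite invr_gt0 ltr0n.
have near0 x : 0 <= x <= 1 -> `|iter n (gk_op M) f x - 0| <= B.
  by rewrite subr0; apply: normr_iter_gk_op_le.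
have := gauss_primitive_near Gf near0 (lexx 0) (ltW M1).
rewrite mul0r subr0 addr0 ln1 subr0 => /(_ _)/le_trans; apply.
  by rewrite invf_le1 ?ltr0n // ler1n.
by rewrite ler_wpM2l //; apply: le_ln1Dx; apply: lt_trans M1;
  rewrite oppr_lt0 ltr01.
Qed.

Lemma iter_gk_op_near M F f (c B : R) n x : gauss_primitive F f ->
  0 <= c -> c.-lipschitz_unit_itv f -> (forall x, 0 <= x <= 1 -> `|f x| <= B) ->
  0 <= x <= 1 ->
  `|iter n (gk_op M) f x - (F 1 - F 0) / ln 2| <=
  (7/8) ^+ n * c + (8 + 2 * n%:R) * B / M.+1%:R.
Proof.
move=> Ff c0 fc fB x01.
have [G Gf GF] := gauss_primitive_iter_gk_op M n Ff fB.
set h := iter n (gk_op M) f in Gf *; set d := (7/8) ^+ n * c + 8 * B / M.+1%:R.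
have osc y : 0 <= y <= 1 -> `|h y - h x| <= d.
  move=> y01.
  have := iter_gk_op_lipschitz M n c0 fc fB (x := (y, x)) (conj y01 x01).
  move/le_trans; apply; rewrite ler_piMr //=.
    have B0 : 0 <= B by apply: le_trans (normr_ge0 (f x)) (fB x x01).
    by rewrite addr_ge0 // ?divr_ge0 ?mulr_ge0 ?exprn_ge0 //; lra.
  by rewrite ler_norml; lra.
have := gauss_primitive_near Gf osc (lexx 0) ler01 (lexx 1).
rewrite addr0 ln1 subr0 -[1 + 1]/2 => hG.
have ln20 := ln2_gt0 R; have ln2_half := ln2_ge_half R.
rewrite (_ : h x - _ = (h x * ln 2 - (F 1 - F 0)) / ln 2); last by field; lra.
rewrite normrM [`|(ln 2)^-1|]gtr0_norm ?invr_gt0 // ler_pdivrMr //.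
set r := n%:R * (B / M.+1%:R) in GF.
rewrite (_ : _ + _ = d + 2 * r); last by rewrite /d /r; ring.
have r0 : 0 <= r by apply: le_trans GF.
have : r <= 2 * r * ln 2 by nra.
move: hG GF; rewrite !ler_norml => /andP[? ?] /andP[? ?] ?.
by apply/andP; split; lra.
Qed.

Lemma iter_gk_op_equidistributed F f (c B : R) : gauss_primitive F f ->
  0 <= c -> c.-lipschitz_unit_itv f -> (forall x, 0 <= x <= 1 -> `|f x| <= B) ->
  forall e : R, 0 < e -> exists n, \forall M \near \oo, forall x, 0 <= x <= 1 ->
  `|iter n (gk_op M) f x - (F 1 - F 0) / ln 2| <= e.
Proof.
move=> Ff c0 fc fB e e0; have e20 : 0 < e / 2 by rewrite divr_gt0.
have /filter_ex[n contracted] : \forall n \near \oo, c * (7/8) ^+ n < e / 2.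
  by apply: near_geometric_lt => //; rewrite ger0_norm; lra.
exists n; near=> M => x x01.
apply: le_trans (iter_gk_op_near M n Ff c0 fc fB x01) _.
rewrite [e]splitr lerD //; first by rewrite mulrC ltW.
rewrite ler_pdivrMr ?ltr0n // [leRHS]mulrC -ler_pdivrMr //.
apply: (@le_trans _ _ M%:R); last by rewrite ler_nat.
by near: M; apply: nbhs_infty_ger.
Unshelve. all: by end_near. Qed.

Lemma digit_weight_lipschitz a : (0 < a)%N ->
  2.-lipschitz_unit_itv (@digit_weight R a).
Proof.
case: a => // a _ [y x] /= [y01 x01].
have /andP[y0 _] := y01; have /andP[x0 _] := x01.
have tail_lip m : `|digit_tail m.+1 y - digit_tail m.+1 x| <= `|y - x|.
  apply: le_trans (normr_digit_tailB_le m x0 y0) _.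
  by rewrite ler_piMl // ler_pdivrMr ?exprn_gt0 // mul1r -natrX ler_nat; nia.
rewrite !digit_weightE // (_ : _ - _ = (digit_tail a.+1 y - digit_tail a.+1 x) -
  (digit_tail a.+2 y - digit_tail a.+2 x)); last by ring.
by apply: le_trans (ler_normB _ _) _; rewrite mulr_natl mulr2n lerD.
Qed.

Lemma word_weight_lipschitz s : positive s ->
  (2 * (size s)%:R).-lipschitz_unit_itv (@word_weight R s).
Proof.
elim/last_ind: s => [_ [y x] _ /=|s a IH];
  first by rewrite subrr normr0 mulr0 mul0r.
rewrite all_rcons size_rcons => /andP[a0 s0] [y x] /= [y01 x01].
have inv01 (z : R) : 0 <= z <= 1 -> 0 <= (a%:R + z)^-1 <= 1.
  exact: inv_digit_itv.
have sz0 : 0 <= 2 * (size s)%:R :> R by rewrite mulr_ge0.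
rewrite !word_weight_rcons; set u := (a%:R + x)^-1; set v := (a%:R + y)^-1.
rewrite (_ : _ - _ = (digit_weight a y - digit_weight a x) * word_weight s v +
  digit_weight a x * (word_weight s v - word_weight s u)); last by ring.
apply: le_trans (ler_normD _ _) _.
rewrite -[(size s).+1%:R]nat1r [2 * _]mulrDr mulr1 [leRHS]mulrDl; apply: lerD.
  rewrite normrM -[leRHS]mulr1 ler_pM //.
    exact: (digit_weight_lipschitz a0 (x := (y, x)) (conj y01 x01)).
  by rewrite ger0_norm ?word_weight_le1 ?word_weight_ge0 ?inv01.
rewrite normrM -[leRHS]mul1r ler_pM //.
  by rewrite ger0_norm ?digit_weight_le1 ?digit_weight_ge0 //; case/andP: x01.
apply: le_trans (lipschitz_inv_digit_le sz0 (IH s0) a0 x01 y01) _.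
rewrite ler_wpM2l // ler_pdivrMr ?exprn_gt0 ?ltr0n //.
by rewrite ler_peMr // -natrX ler1n expn_gt0 a0.
Qed.

Lemma gauss_primitive_word_weight s : positive s ->
  gauss_primitive (fun x => (-1) ^+ size s * ln (1 + cf_eval s x))
                  (word_weight s).
Proof.
elim/last_ind: s => [_ x x0|s a IH].
  rewrite /= (_ : (fun y => _) = (fun y : R => ln (1 + y))).
    exact: gauss_primitive_ln1D.
  by apply/funext => y /=; rewrite mul1r.
rewrite all_rcons => /andP[a0 s0]; have := gauss_primitive_digit a0 (IH s0).
rewrite (_ : word_weight (rcons s a) =
   fun x => digit_weight a x * word_weight s (a%:R + x)^-1); last first.
  by apply/funext => x; rewrite word_weight_rcons.
rewrite (_ : (fun x => _ * ln (1 + cf_eval (rcons s a) x)) =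
  fun x => - ((-1) ^+ size s * ln (1 + cf_eval s (a%:R + x)^-1))) //.
by apply/funext => x; rewrite size_rcons exprS mulN1r mulNr cf_eval_rcons.
Qed.

(* The endpoints of the cylinder of [s] are [cf_eval s 0] and [cf_eval s 1]; the
   sign is their order. *)
Definition gauss_mass s : R :=
  ((-1) ^+ size s * (ln (1 + cf_eval s 1) - ln (1 + cf_eval s 0))) / ln 2.

Lemma normr_word_weight_le1 s x : positive s -> 0 <= x <= 1 ->
  `|word_weight s x| <= 1.
Proof.
by move=> s0 x01; rewrite ger0_norm ?word_weight_ge0 ?word_weight_le1.
Qed.

Lemma word_weight_equidistributed s : positive s ->
  forall e : R, 0 < e -> exists n, \forall M \near \oo, forall x, 0 <= x <= 1 ->
  `|iter n (gk_op M) (word_weight s) x - gauss_mass s| <= e.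
Proof.
move=> s0; rewrite /gauss_mass mulrBr.
apply: (iter_gk_op_equidistributed (gauss_primitive_word_weight s0) _
  (word_weight_lipschitz s0) (fun x => normr_word_weight_le1 s0)).
by rewrite mulr_ge0.
Qed.

Lemma gauss_mass_itv s : positive s -> 0 <= gauss_mass s <= 1.
Proof.
move=> s0; have Fs := gauss_primitive_word_weight s0.
have near_half x : 0 <= x <= 1 -> `|word_weight s x - 2^-1| <= 2^-1.
  move=> x01; have := word_weight_ge0 s0 x01; have := word_weight_le1 s0 x01.
  by rewrite ler_norml; lra.
have := gauss_primitive_near Fs near_half (lexx 0) ler01 (lexx 1).
rewrite addr0 ln1 subr0 -[1 + 1]/2 -mulrBr ler_norml.
rewrite /gauss_mass ler_pdivrMr ?ln2_gt0 // ler_pdivlMr ?ln2_gt0 // mul0r mul1r.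
by lra.
Qed.

End GaussPrimitive.

(** * Large deviations *)

Section Words.
Implicit Types (w s : seq nat) (M L : nat).

Fixpoint words M L : seq (seq nat) :=
  if L is L'.+1 then [seq a :: w | a <- index_iota 1 M.+1, w <- words M L']
  else [:: [::]].

Lemma mem_words M L w :
  (w \in words M L) = (size w == L) && all (fun d => 0 < d <= M)%N w.
Proof.
elim: L w => [|L IH] [|a w] //=.
  by apply/negbTE/allpairsP => -[[b v] /= [_ _]].
rewrite eqSS; apply/allpairsP/idP => [[[b v] /= [+ + [-> ->]]]|].
  by rewrite mem_index_iota IH ltnS => -> /andP[-> ->].
move=> /and3P[sw aM wM]; exists (a, w); split => //=.
  by rewrite mem_index_iota ltnS.
by rewrite IH sw.
Qed.

Lemma words_uniq M L : uniq (words M L).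
Proof.
elim: L => //= L IH; apply: allpairs_uniq => //; first exact: iota_uniq.
by move=> [a w] [b v] /= _ _ [-> ->].
Qed.

Lemma words_positive M L w : w \in words M L -> positive w.
Proof. by rewrite mem_words => /andP[_]; apply: sub_all => d /andP[]. Qed.

Lemma words_size M L w : w \in words M L -> size w = L.
Proof. by rewrite mem_words => /andP[/eqP]. Qed.

Lemma sum_words_cat (V : nmodType) M L1 L2 (F : seq nat -> V) :
  \sum_(w <- words M (L1 + L2)) F w =
  \sum_(w1 <- words M L1) \sum_(w2 <- words M L2) F (w1 ++ w2).
Proof.
elim: L1 F => [|L1 IH] F; first by rewrite add0n big_seq1.
rewrite addSn /= !big_allpairs_dep /=.
by apply: eq_bigr => a _; rewrite (IH (fun w => F (a :: w))).
Qed.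

Lemma sum_words_prod (V : comPzSemiRingType) (f : nat -> V) M L :
  \sum_(w <- words M L) \prod_(d <- w) f d = (\sum_(1 <= d < M.+1) f d) ^+ L.
Proof.
elim: L => [|L IH]; first by rewrite big_seq1 big_nil.
rewrite /= big_allpairs_dep /= exprS big_distrl /=; apply: eq_bigr => a _.
by rewrite -IH big_distrr /=; apply: eq_bigr => w _; rewrite big_cons.
Qed.

End Words.

Section WordMean.
Variable R : realType.
Implicit Types (x y : R) (w s : seq nat) (F G : seq nat -> R) (M L : nat).

Definition word_mean M L F x : R := \sum_(w <- words M L) word_weight w x * F w.

Lemma ler_word_mean M L F G x : 0 <= x <= 1 ->
  {in words M L, forall w, F w <= G w} ->
  word_mean M L F x <= word_mean M L G x.
Proof.
move=> x01 FG; rewrite /word_mean big_seq [leRHS]big_seq;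
  apply: ler_sum => w wM.
by rewrite ler_wpM2l ?FG // word_weight_ge0 // (words_positive wM).
Qed.

Lemma eq_word_mean M L F G x :
  {in words M L, F =1 G} -> word_mean M L F x = word_mean M L G x.
Proof. by move=> FG; apply: eq_big_seq => w wM; rewrite FG. Qed.

Lemma word_meanZ M L (c : R) F x :
  word_mean M L (fun w => c * F w) x = c * word_mean M L F x.
Proof.
by rewrite /word_mean big_distrr; apply: eq_bigr => w _; rewrite /= mulrCA.
Qed.

Lemma word_mean_sum (I : Type) (r : seq I) M L (F : I -> seq nat -> R) x :
  word_mean M L (fun w => \sum_(i <- r) F i w) x =
  \sum_(i <- r) word_mean M L (F i) x.
Proof.
by rewrite /word_mean exchange_big; apply: eq_bigr => w _;
  rewrite /= big_distrr.
Qed.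

Lemma word_mean_cf_eval M n (f : R -> R) x :
  word_mean M n (fun w => f (cf_eval w x)) x = iter n (gk_op M) f x.
Proof.
elim: n f => [|n IH] f; first by rewrite /word_mean big_seq1 /= mul1r.
rewrite iterSr -IH /word_mean /= big_allpairs_dep /= exchange_big /=.
apply: eq_bigr => w _; rewrite /gk_op big_distrr /=.
by apply: eq_bigr => a _; rewrite mulrA [_ * word_weight _ _]mulrC.
Qed.

Lemma word_mean1_le M L x : 0 <= x <= 1 -> word_mean M L (fun=> 1) x <= 1.
Proof.
move=> x01; rewrite (word_mean_cf_eval M L (fun=> 1));
  apply: le_trans (ler_norm _) _.
by apply: normr_iter_gk_op_le => // *; rewrite normr1.
Qed.

Lemma word_mean_affine_le M L (u : R) F x : 0 <= x <= 1 ->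
  word_mean M L (fun w => 1 + u * F w) x <= 1 + u * word_mean M L F x.
Proof.
move=> x01; rewrite -word_meanZ /word_mean;
  under eq_bigr => w _ do rewrite mulrDr.
by rewrite big_split /= lerD2r; apply: word_mean1_le.
Qed.

Lemma word_mean_cat M L1 L2 F x :
  word_mean M (L1 + L2) F x =
  word_mean M L2
    (fun w2 => word_mean M L1 (fun w1 => F (w1 ++ w2)) (cf_eval w2 x)) x.
Proof.
rewrite /word_mean sum_words_cat exchange_big; apply: eq_bigr => w2 _ /=.
by rewrite big_distrr; apply: eq_bigr => w1 _; rewrite word_weight_cat /= mulrA
  [word_weight w2 x * _]mulrC.
Qed.

Lemma word_mean_cat_le M L1 L2 F F1 F2 (A1 A2 : R) x : 0 <= x <= 1 ->
  (forall w1 w2, w1 \in words M L1 -> w2 \in words M L2 ->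
     F (w1 ++ w2) <= F1 w1 * F2 w2) ->
  (forall w, 0 <= F2 w) -> 0 <= A1 ->
  (forall y, 0 <= y <= 1 -> word_mean M L1 F1 y <= A1) ->
  word_mean M L2 F2 x <= A2 ->
  word_mean M (L1 + L2) F x <= A1 * A2.
Proof.
move=> x01 F12 F20 A10 le1 le2; rewrite word_mean_cat.
apply: le_trans (ler_wpM2l A10 le2); rewrite -word_meanZ.
apply: ler_word_mean => // w2 w2M.
have y01 := cf_eval_itv (words_positive w2M) x01.
apply: (@le_trans _ _ (F2 w2 * word_mean M L1 F1 (cf_eval w2 x))).
  rewrite -word_meanZ; apply: ler_word_mean => // w1 w1M.
  by rewrite mulrC F12.
by rewrite mulrC ler_wpM2r ?le1.
Qed.

Lemma word_mean_drop_le M L r F (A : R) x : 0 <= x <= 1 -> (r <= L)%N ->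
  (forall w, 0 <= F w) -> word_mean M (L - r) F x <= A ->
  word_mean M L (fun w => F (drop r w)) x <= A.
Proof.
move=> x01 rL F0 le_A; rewrite -[A]mul1r -[in X in X <= _](subnKC rL).
apply: (word_mean_cat_le (F1 := fun=> 1) (F2 := F)) => //.
  by move=> w1 w2 w1M _; rewrite mul1r drop_size_cat // (words_size w1M).
by move=> y; apply: word_mean1_le.
Qed.

Lemma markov_word_mean M L (P : pred (seq nat)) F x : 0 <= x <= 1 ->
  (forall w, 0 <= F w) -> {in words M L, forall w, P w -> 1 <= F w} ->
  \sum_(w <- words M L | P w) word_weight w x <= word_mean M L F x.
Proof.
move=> x01 F0 PF; rewrite big_mkcond.
apply: (@le_trans _ _ (word_mean M L (fun w => (P w)%:R) x)).
  by rewrite /word_mean; apply: ler_sum => w _; case: (P w);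
    rewrite ?mulr1 ?mulr0.
apply: ler_word_mean => // w wM.
by have := PF w wM; case: (P w) => //= ->.
Qed.

Lemma word_mean_eq_word M s x : all (fun d => 0 < d <= M)%N s ->
  word_mean M (size s) (fun w => (s == w)%:R) x = word_weight s x.
Proof.
move=> sM; rewrite /word_mean (bigD1_seq s) ?words_uniq ?mem_words ?eqxx //=.
rewrite mulr1 big1 ?addr0 // => w.
by rewrite eq_sym => /negbTE ->; rewrite mulr0.
Qed.

End WordMean.

Section Deviations.
Variable R : realType.
Implicit Types (x y : R) (w s : seq nat) (M L b : nat) (m t : R).

Definition centered s m w : R := (prefix s w)%:R - m.

Definition deviation s m w : R :=
  \sum_(0 <= i < size w) centered s m (drop i w).

Definition block_deviation s m b J w : R :=
  \sum_(0 <= j < J) centered s m (drop (j * b) w).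

Lemma centered_cat s m w1 w2 : (size s <= size w1)%N ->
  centered s m (w1 ++ w2) = centered s m w1.
Proof. by move=> sw; rewrite /centered !prefixE takel_cat. Qed.

Lemma normr_centered_le1 s m w : 0 <= m <= 1 -> `|centered s m w| <= 1.
Proof.
by move=> /andP[m0 m1]; rewrite /centered ler_norml; case: prefix => /=; lra.
Qed.

Lemma normr_sum_centered_le s m w i j : 0 <= m <= 1 ->
  `|\sum_(i <= l < j) centered s m (drop l w)| <= (j - i)%:R.
Proof.
move=> m01; apply: le_trans (ler_norm_sum _ _ _) _.
rewrite -[leRHS]mulr1 mulr_natl -sumr_const_nat.
by apply: ler_sum => l _; apply: normr_centered_le1.
Qed.

Lemma normr_deviation_le s m w : 0 <= m <= 1 ->
  `|deviation s m w| <= (size w)%:R.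
Proof.
by move=> m01; rewrite -[X in X%:R]subn0; apply: normr_sum_centered_le.
Qed.

Lemma block_deviation_catS s m b J w1 w2 : (size s <= b)%N -> size w1 = b ->
  block_deviation s m b J.+1 (w1 ++ w2) =
  centered s m w1 + block_deviation s m b J w2.
Proof.
move=> sb w1b; rewrite /block_deviation big_nat_recl // mul0n drop0.
rewrite centered_cat ?w1b //; congr (_ + _); apply: eq_bigr => j _.
by rewrite mulSn addnC -drop_drop -{2}w1b drop_size_cat.
Qed.

Lemma deviation_sub_blocks_le s m b w : (0 < b)%N -> 0 <= m <= 1 ->
  `|deviation s m w -
    \sum_(0 <= r < b) block_deviation s m b (size w %/ b).-1 (drop r w)|
  <= 2 * b%:R.
Proof.
move=> b0 m01; set J := (_ %/ b).-1; set L := size w.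
have JL : (J * b <= L)%N.
  by apply: leq_trans (leq_divM L b); rewrite leq_mul2r leq_pred orbT.
have LJ : (L <= J * b + 2 * b)%N.
  have := ltn_ceil L b0; rewrite -mulnDl addn2; move/ltnW/leq_trans; apply.
  by rewrite leq_mul2r; apply/orP; right; rewrite /J; case: (L %/ b)%N.
have -> : \sum_(0 <= r < b) block_deviation s m b J (drop r w) =
    \sum_(0 <= i < J * b) centered s m (drop i w).
  rewrite (sum_nat_blocks (fun i => centered s m (drop i w))).
  apply: eq_bigr => r _; apply: eq_bigr => j _.
  by rewrite drop_drop [(r + _)%N]addnC.
rewrite /deviation (big_cat_nat _ JL) //= addrAC subrr add0r.
apply: le_trans (normr_sum_centered_le _ _ _ _ m01) _.
by rewrite -natrM ler_nat leq_subLR.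
Qed.

Lemma word_mean_expR_centered_le M n s m (e t x : R) :
  all (fun d => 0 < d <= M)%N s -> 0 <= m <= 1 -> `|t| <= 2^-1 ->
  (forall y, 0 <= y <= 1 -> `|iter n (gk_op M) (word_weight s) y - m| <= e) ->
  0 <= x <= 1 ->
  word_mean M (size s + n) (fun w => expR (t * centered s m w)) x <=
  expR (2 * t ^+ 2 + 2 * `|t| * e).
Proof.
move=> sM m01 t2 mixing x01; set u := expR t - 1.
have bernoulli w1 w2 : w1 \in words M (size s) ->
    expR (t * centered s m (w1 ++ w2)) =
    expR (- (t * m)) * (1 + u * (s == w1)%:R).
  move=> /words_size w1s.
  rewrite /centered prefixE -w1s take_size_cat // eq_sym.
  rewrite mulrBr expRD mulrC; congr (_ * _).
  by case: eqP => _; rewrite ?mulr1 ?mulr0 ?expR0 /u; ring.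
have -> : word_mean M (size s + n) (fun w => expR (t * centered s m w)) x =
    expR (- (t * m)) * word_mean M n (fun w2 =>
      word_mean M (size s) (fun w1 => 1 + u * (s == w1)%:R) (cf_eval w2 x)) x.
  rewrite word_mean_cat -word_meanZ; apply: eq_word_mean => w2 _.
  by rewrite -word_meanZ; apply: eq_word_mean => w1 /bernoulli.
rewrite expRN ler_pdivrMl ?expR_gt0 // -expRD addrA.
apply: le_trans (bernoulli_mgf_le t2 m01 (mixing x x01)).
rewrite -word_mean_cf_eval; apply: le_trans (word_mean_affine_le _ _ _ _ x01).
apply: ler_word_mean => // w2 w2M; rewrite -(word_mean_eq_word _ sM).
by apply: word_mean_affine_le; apply: cf_eval_itv x01;
  apply: words_positive w2M.
Qed.

Lemma word_mean_expR_blocks_le M s b m (q t : R) :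
  (size s <= b)%N -> (forall x, 0 <= x <= 1 ->
    word_mean M b (fun w => expR (t * centered s m w)) x <= expR q) ->
  forall J L, (J * b <= L)%N -> forall x, 0 <= x <= 1 ->
  word_mean M L (fun w => expR (t * block_deviation s m b J w)) x
  <= expR (J%:R * q).
Proof.
move=> sb block_le; elim=> [|J IH] L JL x x01.
  rewrite mul0r expR0; apply: le_trans (word_mean1_le M L x01).
  apply: ler_word_mean => // w _.
  by rewrite /block_deviation big_geq // mulr0 expR0.
have bL : (b <= L)%N by apply: leq_trans JL; rewrite mulSn leq_addr.
rewrite -(subnKC bL) -nat1r mulrDl mul1r expRD.
apply: (word_mean_cat_le (F1 := fun w => expR (t * centered s m w))
  (F2 := fun w => expR (t * block_deviation s m b J w))) => //.
- move=> w1 w2 /words_size w1b _.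
  by rewrite block_deviation_catS // mulrDr expRD.
- by apply: IH => //; rewrite leq_subRL // -mulSn.
Qed.

Lemma word_mean_expR_shifted_blocks_le M L s b m (q t x : R) r :
  (size s <= b)%N -> (forall y, 0 <= y <= 1 ->
    word_mean M b (fun w => expR (t * centered s m w)) y <= expR q) ->
  (r < b)%N -> 0 <= x <= 1 ->
  word_mean M L
    (fun w => expR (t * block_deviation s m b (L %/ b).-1 (drop r w))) x
  <= expR ((L %/ b).-1%:R * q).
Proof.
move=> sb block_le rb x01; have [->|J0] := eqVneq (L %/ b).-1 0%N.
  rewrite mul0r expR0; apply: le_trans (word_mean1_le M L x01).
  apply: ler_word_mean => // w _.
  by rewrite /block_deviation big_geq // mulr0 expR0.
have JL : (r + (L %/ b).-1 * b <= L)%N.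
  apply: leq_trans (leq_divM L b).
  by case: (L %/ b)%N J0 => // J _; rewrite mulSn leq_add2r ltnW.
have rL : (r <= L)%N by apply: leq_trans JL; rewrite leq_addr.
apply: (word_mean_drop_le
  (F := fun w => expR (t * block_deviation s m b (L %/ b).-1 w)) x01 rL).
  by move=> w; apply: expR_ge0.
by apply: (word_mean_expR_blocks_le sb block_le); rewrite // leq_subRL.
Qed.

Lemma deviation_tail_le M L s b m (q t e x : R) :
  (0 < b)%N -> (size s <= b)%N -> 0 <= m <= 1 -> 0 <= x <= 1 ->
  (forall y, 0 <= y <= 1 ->
    word_mean M b (fun w => expR (t * centered s m w)) y <= expR q) ->
  0 <= q -> `|t| <= 2^-1 ->
  \sum_(w <- words M L | `|t| * e * L%:R <= t * deviation s m w) word_weight w x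
  <= expR (1 + L%:R / b%:R * (q - `|t| * e)).
Proof.
move=> b0 sb m01 x01 block_le q0 t2; have b0' : 0 < b%:R :> R by rewrite ltr0n.
set J := (L %/ b).-1; set z := `|t| * e * L%:R / b%:R - 1.
pose Y r w := t * block_deviation s m b J (drop r w).
have Jq : J%:R * q <= L%:R / b%:R * q.
  rewrite ler_wpM2r // ler_pdivlMr // -natrM ler_nat.
  by apply: leq_trans (leq_divM L b); rewrite leq_mul2r leq_pred orbT.
have mean_le r : (r < b)%N ->
  word_mean M L (fun w => expR (Y r w)) x <= expR (J%:R * q).
  by move=> rb; apply: word_mean_expR_shifted_blocks_le.
apply: le_trans (markov_word_mean
  (F := fun w => expR (- z) / b%:R * \sum_(0 <= r < b) expR (Y r w)) x01 _ _) _.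
- move=> w; rewrite mulr_ge0 ?divr_ge0 ?expR_ge0 //.
  by apply: sumr_ge0 => r _; apply: expR_ge0.
- move=> w /words_size wL large.
  rewrite mulrAC expRN -mulrA mulrC ler_pdivlMr ?expR_gt0 //.
  rewrite mul1r ler_pdivlMr // mulrC; apply: le_trans (expR_mean_le _ b0).
  rewrite ler_wpM2l // ler_expR ler_pdivlMr // /z mulrBl mul1r divfK ?gt_eqF //.
  have := deviation_sub_blocks_le s w b0 m01.
  rewrite wL -/J => /(ler_wpM2l (normr_ge0 t)).
  rewrite -normrM mulrBr => /(le_trans (ler_norm _)).
  have : `|t| * (2 * b%:R) <= b%:R by rewrite mulrA ler_piMl //; lra.
  by rewrite /Y -big_distrr /=; lra.
rewrite word_meanZ word_mean_sum.
apply: (@le_trans _ _ (expR (- z) / b%:R * (b%:R * expR (J%:R * q)))).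
  rewrite ler_wpM2l ?divr_ge0 ?expR_ge0 //.
  rewrite mulr_natl -[b in _ *+ b]subn0 -sumr_const_nat.
  by apply: ler_sum_nat => r /andP[_]; apply: mean_le.
rewrite mulrA divfK ?gt_eqF // -expRD ler_expR /z mulrBr; lra.
Qed.

Lemma deviation_large_le s (e : R) : (0 < size s)%N -> positive s ->
  0 < e <= 1 ->
  exists2 c : R, 0 < c & \forall M \near \oo, forall L x, 0 <= x <= 1 ->
   \sum_(w <- words M L | e * L%:R <= `|deviation s (gauss_mass R s) w|)
     word_weight w x <= 2 * expR (1 - c * L%:R).
Proof.
move=> s1 s0 /andP[e0 e1]; set m := gauss_mass R s.
have m01 : 0 <= m <= 1 by apply: gauss_mass_itv.
have e80 : 0 < e / 8 by lra.
have [n mixing] := word_weight_equidistributed s0 e80.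
set b := (size s + n)%N; set t := e / 8; set c := e ^+ 2 / 16 / b%:R.
have b0 : (0 < b)%N by rewrite addn_gt0 s1.
exists c; first by rewrite !divr_gt0 ?exprn_gt0 ?ltr0n.
near=> M => L x x01.
have sM : all (fun d => 0 < d <= M)%N s.
  apply/allP => d ds; rewrite (allP s0) //=.
  have le_M : (\max_(d <- s) d <= M)%N by near: M; apply: nbhs_infty_ge.
  by apply: leq_trans le_M; apply: leq_bigmax_seq.
have mixingM : forall y, 0 <= y <= 1 ->
  `|iter n (gk_op M) (word_weight s) y - m| <= e / 8 by near: M.
have tail (u : R) : `|u| = t ->
   \sum_(w <- words M L | `|u| * e * L%:R <= u * deviation s m w)
     word_weight w x
   <= expR (1 - c * L%:R).
  move=> ut; have u2 : u ^+ 2 = t ^+ 2 by rewrite -ut real_normK ?num_real.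
  rewrite [1 - _](_ : _ =
      1 + L%:R / b%:R * (2 * u ^+ 2 + 2 * `|u| * (e / 8) - `|u| * e));
    last first.
    by rewrite u2 ut /c /t; field; rewrite pnatr_eq0 -lt0n.
  have u_le : `|u| <= 2^-1 by rewrite ut /t; lra.
  apply: deviation_tail_le => //; first by rewrite leq_addr.
    by move=> y; apply: word_mean_expR_centered_le.
  by rewrite ut /t; have := sqr_ge0 u; nra.
rewrite mulr_natl mulr2n.
apply: le_trans (lerD (tail t _) (tail (- t) _)); rewrite ?normrN ?gtr0_norm //.
apply: ler_sum_orb => w wM;
  first by rewrite word_weight_ge0 // (words_positive wM).
rewrite mulNr -mulrN -!mulrA !ler_pM2l //.
by rewrite ler_normr.
Unshelve. all: by end_near. Qed.

End Deviations.

(** * Words with bounded denominator *)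

Section Denominators.
Variable R : realType.
Implicit Types (x y : R) (w : seq nat) (a Q : nat).

Lemma cf_tails_nil x : cf_tails [::] x = 1.
Proof. by rewrite /cf_tails big_ord0. Qed.

Lemma cf_tails_cons a w x :
  cf_tails (a :: w) x = cf_eval (a :: w) x * cf_tails w x.
Proof. by rewrite /cf_tails /= big_ord_recl. Qed.

Lemma cf_tails_gt0 w x : positive w -> 0 <= x <= 1 -> 0 < cf_tails w x.
Proof.
elim: w => [|a w IH] /=; first by rewrite cf_tails_nil.
move=> /andP[a0 w0] x01; rewrite cf_tails_cons mulr_gt0 ?IH //= invr_gt0.
by rewrite ltr_wpDr ?ltr0n //; case/andP: (cf_eval_itv w0 x01).
Qed.

Lemma word_weight_tails w x : positive w -> 0 <= x <= 1 ->
  word_weight w x = cf_tails w x ^+ 2 * (1 + x) / (1 + cf_eval w x).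
Proof.
move=> + x01; elim: w => [|a w IH] /=.
  by rewrite cf_tails_nil expr1n mul1r divff //; lra.
move=> /andP[a0 w0]; rewrite IH // cf_tails_cons /= /digit_weight.
have a1 : 1 <= a%:R :> R by rewrite ler1n.
have /andP[y0 y1] := cf_eval_itv w0 x01; set y := cf_eval w x in y0 y1 *.
by field; do ?[apply/andP; split]; lra.
Qed.

Lemma prod_digits_le_tails w x : positive w -> 0 <= x <= 1 ->
  (\prod_(d <- w) d)%N%:R <= (cf_tails w x)^-1.
Proof.
move=> + x01; elim: w => [|a w IH] /=;
  first by rewrite big_nil cf_tails_nil invr1.
move=> /andP[a0 w0]; rewrite big_cons cf_tails_cons natrM invfM /= invrK.
by apply: ler_pM; rewrite ?IH // lerDl; case/andP: (cf_eval_itv w0 x01).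
Qed.

(* Consecutive tails u, v of an expansion satisfy u * v = v / (a + v) <= 1/2. *)
Lemma sqr_cf_tails_cons_le a w x : positive (a :: w) -> 0 <= x <= 1 ->
  cf_tails (a :: w) x ^+ 2 <= cf_eval (a :: w) x * 2^-1 ^+ size w.
Proof.
move=> + x01; elim: w a => [|b w IH] a.
  move=> p; rewrite cf_tails_cons cf_tails_nil expr0 !mulr1.
  by have /andP[u0 u1] := cf_eval_itv p x01; rewrite expr2 ler_piMl.
move=> /andP[a0 bw]; rewrite cf_tails_cons exprMn.
have := IH b bw; have /andP[v0 v1] := @cf_eval_itv R (b :: w) x bw x01.
have a1 : 1 <= a%:R :> R by rewrite ler1n.
set v := cf_eval (b :: w) x in v0 v1 *; set T := cf_tails (b :: w) x => vT.
have -> : cf_eval (a :: b :: w) x = (a%:R + v)^-1 by [].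
set u := (a%:R + v)^-1; have u0 : 0 < u by rewrite invr_gt0; lra.
have uv : u * v <= 2^-1 by rewrite mulrC ler_pdivrMr; lra.
rewrite [size _]/= [2^-1 ^+ _]exprS; set K := 2^-1 ^+ size w in vT *.
have K0 : 0 <= K by rewrite exprn_ge0 // invr_ge0.
apply: (@le_trans _ _ (u ^+ 2 * (v * K))).
  by rewrite ler_wpM2l // exprn_ge0 // ltW.
rewrite (_ : u ^+ 2 * _ = u * ((u * v) * K)); last by ring.
by rewrite ler_wpM2l ?(ltW u0) // ler_wpM2r.
Qed.

Lemma sqr_cf_tails_le w x : positive w -> 0 <= x <= 1 ->
  cf_tails w x ^+ 2 <= 2 * 2^-1 ^+ size w.
Proof.
case: w => [|a w] w0 x01;
  first by rewrite cf_tails_nil expr1n expr0 mulr1 ler1n.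
apply: le_trans (sqr_cf_tails_cons_le w0 x01) _.
rewrite [size _]/= exprS mulrA divff ?pnatr_eq0 // mul1r ler_piMl ?exprn_ge0
  ?invr_ge0 //.
by case/andP: (cf_eval_itv w0 x01).
Qed.

Definition denom_le Q w : bool := positive w && (Q%:R^-1 <= cf_tails w 0 :> R).

Lemma prod_digits_gt0 w : positive w -> (0 < \prod_(d <- w) d)%N.
Proof. by move=> w0; rewrite big_seq prodn_cond_gt0 // => d /(allP w0). Qed.

Let zero_itv : 0 <= (0 : R) <= 1.
Proof. by rewrite lexx ler01. Qed.

Lemma denom_le_inv_tails Q w : denom_le Q w -> (0 < Q)%N ->
  (cf_tails w 0)^-1 <= Q%:R :> R.
Proof.
move=> /andP[w0 Qw] Q0.
by rewrite -[leRHS]invrK lef_pV2 ?posrE ?invr_gt0 ?ltr0n ?cf_tails_gt0.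
Qed.

Lemma denom_le_prod Q w : (0 < Q)%N -> denom_le Q w ->
  (\prod_(d <- w) d <= Q)%N.
Proof.
move=> Q0 Qw; rewrite -(ler_nat R); apply: le_trans (denom_le_inv_tails Qw Q0).
by apply: prod_digits_le_tails zero_itv; case/andP: Qw.
Qed.

Lemma denom_le_words Q w : (0 < Q)%N -> denom_le Q w -> w \in words Q (size w).
Proof.
move=> Q0 Qw; have /andP[w0 _] := Qw.
rewrite mem_words eqxx; apply/allP => d dw; rewrite (allP w0) //=.
apply: leq_trans (denom_le_prod Q0 Qw); rewrite (big_rem d) //= leq_pmulr //.
by apply: prod_digits_gt0; apply/allP => c /mem_rem /(allP w0).
Qed.

Lemma denom_le_word_weight Q w : (0 < Q)%N -> denom_le Q w ->
  1 <= 2 * Q%:R ^+ 2 * word_weight w 0 :> R.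
Proof.
move=> Q0 /andP[w0 Qw]; rewrite word_weight_tails // addr0 mulr1.
have /andP[e0 e1] := cf_eval_itv w0 zero_itv.
have Qt : 1 <= Q%:R * cf_tails w 0 :> R by rewrite -ler_pdivrMl ?ltr0n // mulr1.
rewrite (_ : _ * _ = (Q%:R * cf_tails w 0) ^+ 2 * (2 / (1 + cf_eval w 0)));
  last first.
  by field; lra.
by rewrite mulr_ege1 ?exprn_ege1 // ler_pdivlMr; lra.
Qed.

Lemma denom_le_size Q w : (0 < Q)%N -> denom_le Q w ->
  (size w)%:R <= 4 * ln Q%:R + 1 :> R.
Proof.
move=> Q0 /andP[w0 Qw]; have Q0' : 0 < Q%:R :> R by rewrite ltr0n.
have two_pow_le : 2 ^+ size w <= 2 * Q%:R ^+ 2 :> R.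
  have : Q%:R^-1 ^+ 2 <= 2 * 2^-1 ^+ size w :> R.
    apply: le_trans (sqr_cf_tails_le w0 zero_itv).
    by rewrite lerXn2r ?nnegrE ?invr_ge0 // ltW // cf_tails_gt0.
  by rewrite !exprVn ler_pdivlMr ?exprn_gt0 // mulrC ler_pdivrMr ?exprn_gt0.
have : ln (2 ^+ size w) <= ln (2 * Q%:R ^+ 2) :> R.
  by rewrite ler_ln ?posrE ?mulr_gt0 ?exprn_gt0.
rewrite lnM ?posrE ?exprn_gt0 // !lnXn //
  -[ln 2 *+ _]mulr_natl -[ln Q%:R *+ _]mulr_natl.
have lnQ0 : 0 <= ln Q%:R :> R by rewrite ln_ge0 // ler1n.
have := ln2_ge_half R; have : 0 <= (size w)%:R :> R by [].
nra.
Qed.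

End Denominators.

(** * Expansions of rationals *)

Section RationalExpansions.
Variable R : realType.
Implicit Types (x : R) (p q n k : nat).

#[local] Arguments cf_digit : simpl never.

Lemma gauss0 : gauss (0 : R) = 0.
Proof. by rewrite /gauss eqxx. Qed.

Lemma cf_digit_gauss x i : gauss x != 0 ->
  cf_digit x i.+2 = cf_digit (gauss x) i.+1.
Proof.
move=> gx0; rewrite /cf_digit /gauss_orbit.
by case: i => [|i]; rewrite -?iterS ?iterSr //= gx0.
Qed.

Lemma cf_digit1 x : x != 0 -> gauss x != 0 ->
  cf_digit x 1 = Some (Num.truncn x^-1).
Proof. by move=> x0 gx0; rewrite /cf_digit /gauss_orbit /= x0 (negbTE gx0). Qed.

Definition cf_digits x n : seq nat := pmap (cf_digit x) (iota 1 n).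

Lemma cf_digits_recl x n : x != 0 -> gauss x != 0 ->
  cf_digits x n.+1 = Num.truncn x^-1 :: cf_digits (gauss x) n.
Proof.
move=> x0 gx0; rewrite /cf_digits /= cf_digit1 //=; congr (_ :: _).
have : all (leq 1) (iota 1 n) by apply/allP => i; rewrite mem_iota => /andP[].
rewrite -[2%N]/(1 + 1)%N iotaDl; elim: (iota 1 n) => //= -[//|i] l IH /= l1.
by rewrite cf_digit_gauss // IH.
Qed.

Lemma cf_digits_last x n : x != 0 -> gauss x = 0 ->
  cf_digits x n.+2 = [:: (Num.truncn x^-1).-1; 1%N].
Proof.
move=> x0 gx0.
have iter0 i : iter i (@gauss R) 0 = 0 by elim: i => //= i ->; exact: gauss0.
have digit1 : cf_digit x 1 = Some (Num.truncn x^-1).-1.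
  by rewrite /cf_digit /gauss_orbit /= x0 gx0 eqxx.
have digit2 : cf_digit x 2 = Some 1%N.
  by rewrite /cf_digit /gauss_orbit /= gx0 eqxx /= x0.
have digits_end i : (2 < i)%N -> cf_digit x i = None.
  case: i => [|[|[|i]]] // _.
  by rewrite /cf_digit /gauss_orbit !iterSr gx0 gauss0 iter0 eqxx.
rewrite /cf_digits /= digit1 /= digit2 /=; congr [:: _, _ & _].
have : all (leq 3) (iota 3 n) by apply/allP => i; rewrite mem_iota => /andP[].
by elim: (iota 3 n) => //= i l IH /andP[/digits_end -> /IH].
Qed.

Lemma truncn_divn p q : (0 < p)%N -> Num.truncn (q%:R / p%:R : R) = (q %/ p)%N.
Proof.
move=> p0; apply: truncn_def.
have p0' : 0 < p%:R :> R by rewrite ltr0n.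
rewrite ler_pdivlMr // ltr_pdivrMr // -!natrM ler_nat ltr_nat.
by rewrite leq_divM ltn_ceil.
Qed.

Lemma gauss_ratio p q : (0 < p)%N -> (0 < q)%N ->
  gauss (p%:R / q%:R : R) = (q %% p)%N%:R / p%:R.
Proof.
move=> p0 q0; rewrite /gauss.
have p0' : p%:R != 0 :> R by rewrite pnatr_eq0 -lt0n.
have q0' : q%:R != 0 :> R by rewrite pnatr_eq0 -lt0n.
rewrite mulf_eq0 invr_eq0 (negbTE p0') (negbTE q0') /= invf_div truncn_divn //.
by rewrite {1}(divn_eq q p) natrD natrM; field.
Qed.

Lemma modn_coprime_gt0 p q : (1 < p)%N -> coprime p q -> (0 < q %% p)%N.
Proof.
move=> p1 cpq; rewrite lt0n; apply: contraL p1 => /eqP r0;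
  rewrite -leqNgt dvdn_leq //.
by rewrite -(eqP cpq) dvdn_gcd dvdnn /= /dvdn r0.
Qed.

Lemma cf_digits_ratio p q n : (0 < p < q)%N -> coprime p q -> (p < n)%N ->
  let w := cf_digits (p%:R / q%:R : R) n in
  [/\ positive w, (0 < size w)%N, cf_eval w 0 = p%:R / q%:R :> R
    & cf_tails w 0 = q%:R^-1 :> R].
Proof.
elim/ltn_ind: p q n => p IH q n /andP[p0 pq] cpq pn.
have q0 : (0 < q)%N by apply: leq_trans pq.
have p0' : p%:R != 0 :> R by rewrite pnatr_eq0 -lt0n.
have q0' : q%:R != 0 :> R by rewrite pnatr_eq0 -lt0n.
have x0 : p%:R / q%:R != 0 :> R by rewrite mulf_neq0 ?invr_neq0.
have [p1|p_neq1] := eqVneq p 1%N.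
  case: n pn => [|[|n]] //; rewrite p1 // => _.
  rewrite cf_digits_last -?p1 // ?gauss_ratio // ?p1 ?modn1 ?mul0r //.
  rewrite mul1r invrK natrK.
  case: q pq q0' {q0 cpq x0} => [|[|q]]; rewrite ?p1 // => _ _; split => //=.
    by rewrite addr0 invr1 natr1.
  by rewrite !cf_tails_cons cf_tails_nil /= addr0 invr1 natr1 !mulr1.
have p2 : (1 < p)%N by rewrite ltn_neqAle eq_sym p_neq1.
have r0 := modn_coprime_gt0 p2 cpq.
have gx : gauss (p%:R / q%:R : R) = (q %% p)%N%:R / p%:R by rewrite gauss_ratio.
case: n pn => // n pn; rewrite cf_digits_recl //; last first.
  by rewrite gx mulf_neq0 ?invr_neq0 ?pnatr_eq0 -?lt0n.
rewrite gx invf_div truncn_divn //; set r := (q %% p)%N in r0 *.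
have rp : (r < p)%N by rewrite ltn_pmod.
have crp : coprime r p by rewrite coprime_modl coprime_sym.
have := IH r rp p n; rewrite r0 rp => /(_ isT crp (leq_trans rp pn)).
set w := cf_digits _ _ => -[w0 _ ew tw].
have eqq : q%:R = (q %/ p)%:R * p%:R + r%:R :> R
  by rewrite {1}(divn_eq q p) natrD natrM.
have eqq0 : (q %/ p)%:R * p%:R + r%:R != 0 :> R by rewrite -eqq.
split => //.
- by rewrite /= w0 divn_gt0 // ltnW.
- by rewrite /= ew eqq; field; rewrite p0' eqq0.
- by rewrite cf_tails_cons /= ew tw eqq; field; rewrite p0' eqq0.
Qed.

Lemma cf_rat_spec p q : (0 < p < q)%N -> coprime p q ->
  let w := cf_rat R p q in
  [/\ positive w, (0 < size w)%N, cf_eval w 0 = p%:R / q%:R :> R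
    & cf_tails w 0 = q%:R^-1 :> R].
Proof. by move=> pq cpq; apply: cf_digits_ratio => //; lia. Qed.

Lemma cf_rat_inj p q p' q' : (0 < p < q)%N -> coprime p q ->
  (0 < p' < q')%N -> coprime p' q' -> cf_rat R p q = cf_rat R p' q' ->
  (p, q) = (p', q').
Proof.
move=> pq c pq' c' E; have [_ _ e t] := cf_rat_spec pq c.
have [_ _ e' t'] := cf_rat_spec pq' c'; rewrite E in e t.
have qq : q = q'.
  by apply/eqP; rewrite -(eqr_nat R) -(inj_eq (@invr_inj R)) -t -t'.
have q0 : q%:R != 0 :> R by rewrite pnatr_eq0; lia.
suff -> : p = p' by rewrite qq.
by apply/eqP; rewrite -(eqr_nat R) -(inj_eq (mulIf (invr_neq0 q0))) -e e' qq.
Qed.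

End RationalExpansions.

Section Rationals.
Implicit Types (k : subseq_kind) (Q : nat).

Definition rats k Q : seq (nat * nat) :=
  [seq (p, q) | q <- iota 2 Q.-1,
                p <- [seq p <- iota 1 q.-1 | coprime p q && selR k p q]].

Lemma mem_rats k Q pq : pq \in rats k Q ->
  [/\ (0 < pq.1 < pq.2)%N, coprime pq.1 pq.2 & (pq.2 <= Q)%N].
Proof.
move=> /allpairsPdep[q [p [+ + ->]]] /=.
rewrite mem_filter !mem_iota => q2 /andP[/andP[c _] p1].
by split => //; lia.
Qed.

Lemma rats_uniq k Q : uniq (rats k Q).
Proof.
apply: allpairs_uniq_dep; first exact: iota_uniq.
  by move=> q _; apply: filter_uniq; apply: iota_uniq.
by move=> [q p] [q' p'] /= _ _ [-> ->].
Qed.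

Lemma rats_recr k Q : rats k Q.+2 = rats k Q.+1 ++
  [seq (p, Q.+2) |
     p <- [seq p <- iota 1 Q.+1 | coprime p Q.+2 && selR k p Q.+2]].
Proof.
rewrite /rats -[Q.+2.-1]/(Q.+1) (_ : iota 2 Q.+1 = iota 2 Q ++ [:: Q.+2]).
  by rewrite map_cat flatten_cat /= cats0.
by have := iotaD 2 Q 1; rewrite addn1 => ->.
Qed.

Variable R : realType.

Definition rat_words k Q : seq (seq nat) :=
  [seq cf_rat R pq.1 pq.2 | pq <- rats k Q].

Lemma size_rat_words k Q : size (rat_words k Q) = size (rats k Q).
Proof. exact: size_map. Qed.

Lemma concat_prefixE k Q : concat_prefix R k Q = flatten (rat_words k Q).
Proof.
rewrite /concat_prefix /rat_words /rats; elim: (iota 2 Q.-1) => //= q l IH.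
by rewrite map_cat flatten_cat -IH -map_comp.
Qed.

Lemma rat_words_uniq k Q : uniq (rat_words k Q).
Proof.
rewrite map_inj_in_uniq ?rats_uniq // => -[p q] [p' q'] /mem_rats[pq cpq _].
by move=> /mem_rats[pq' cpq' _]; apply: cf_rat_inj.
Qed.

Lemma mem_rat_words k Q w : w \in rat_words k Q ->
  denom_le R Q w /\ (0 < size w)%N.
Proof.
move=> /mapP[[p q] /mem_rats[/= pq cpq qQ] ->].
have [w0 sw _ tw] := cf_rat_spec R pq cpq; split => //.
have q0 : (0 < q)%N by lia.
by rewrite /denom_le w0 tw lef_pV2 ?posrE ?ltr0n ?ler_nat // (leq_trans q0).
Qed.

Lemma rat_words_prefix k Q Q' : (Q <= Q')%N ->
  exists l, rat_words k Q' = rat_words k Q ++ l.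
Proof.
move=> /subnKC <-; elim: (Q' - Q)%N => [|n [l IH]].
  by exists [::]; rewrite addn0 cats0.
rewrite addnS; case: (Q + n)%N IH => [|a] IH; first by exists l; rewrite -IH.
by rewrite /rat_words rats_recr map_cat -/(rat_words k a.+1) IH -catA; eexists.
Qed.

End Rationals.

(** * Counting bad words *)

Section Rankin.
Variable R : realType.
Implicit Types (d Q M L : nat) (w : seq nat).

Definition rankin d : R := (d%:R * Num.sqrt d%:R)^-1.

Lemma rankin_ge0 d : 0 <= rankin d.
Proof. by rewrite invr_ge0 mulr_ge0 ?sqrtr_ge0. Qed.

Lemma prod_rankin w : \prod_(d <- w) rankin d = rankin (\prod_(d <- w) d).
Proof.
elim: w => [|a w IH]; first by rewrite !big_nil /rankin sqrtr1 mulr1 invr1.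
by rewrite !big_cons IH /rankin natrM sqrtrM ?ler0n // -invfM mulrACA.
Qed.

Lemma rankinS_le M :
  rankin M.+2 <= 2 / Num.sqrt M.+1%:R - 2 / Num.sqrt M.+2%:R.
Proof.
rewrite /rankin; set a : R := Num.sqrt M.+1%:R; set b : R := Num.sqrt M.+2%:R.
have a0 : 0 < a by rewrite sqrtr_gt0 ltr0n.
have b0 : 0 < b by rewrite sqrtr_gt0 ltr0n.
have ab : a <= b by rewrite ler_wsqrtr // ler_nat.
have sqr_ab : b ^+ 2 = a ^+ 2 + 1 by rewrite !sqr_sqrtr ?ler0n // natr1.
have -> : M.+2%:R = b ^+ 2 :> R by rewrite sqr_sqrtr.
rewrite (_ : 2 / a - 2 / b = 2 * (b - a) / (a * b));
  last by field; rewrite !gt_eqF.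
rewrite -[leLHS]mul1r ler_pdivlMr ?mulr_gt0 // mulrAC ler_pdivrMr ?mulr_gt0
  ?exprn_gt0 //.
have conj_ab : (b - a) * (b + a) = 1 by rewrite -subr_sqr sqr_ab; ring.
rewrite mul1r mulrA; apply: ler_pM; rewrite ?(ltW a0) ?(ltW b0) //; try lra.
apply: (@le_trans _ _ (b * ((b - a) * (b + a))));
  first by rewrite conj_ab mulr1.
rewrite (_ : b * _ = (b - a) * b * (b + a)); last by ring.
rewrite (_ : 2 * _ * _ = (b - a) * b * (2 * b)); last by ring.
by rewrite ler_wpM2l ?mulr_ge0 //; lra.
Qed.

Lemma sum_rankin_le M : \sum_(1 <= d < M.+1) rankin d <= 3.
Proof.
case: M => [|M]; first by rewrite big_geq.
suff : \sum_(1 <= d < M.+2) rankin d <= 3 - 2 / Num.sqrt M.+1%:R.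
  by move/le_trans; apply; rewrite gerBl divr_ge0 ?sqrtr_ge0.
elim: M => [|M IH]; first by rewrite big_nat1 /rankin sqrtr1; lra.
by rewrite big_nat_recr //=; have := rankinS_le M; lra.
Qed.

(* Rankin's trick: a word whose digits have product [P <= Q] is counted with the
   weight [(Q / P) ^ (3/2) >= 1]. *)
Lemma count_words_prod_le M L Q :
  (count (fun w => positive w && (\prod_(d <- w) d <= Q)%N) (words M L))%:R
  <= Q%:R * Num.sqrt Q%:R * 3 ^+ L :> R.
Proof.
apply: (@le_trans _ _
    (\sum_(w <- words M L) Q%:R * Num.sqrt Q%:R * \prod_(d <- w) rankin d)).
  apply: natr_count_le_sum => w _; rewrite prod_rankin.
  case: andP => [[w0 wQ]|_]; last by rewrite !mulr_ge0 ?sqrtr_ge0 ?rankin_ge0.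
  have P0 := prod_digits_gt0 w0.
  rewrite ler_pdivlMr ?mulr_gt0 ?sqrtr_gt0 ?ltr0n // mul1r.
  by apply: ler_pM; rewrite ?sqrtr_ge0 ?ler_wsqrtr ?ler_nat.
rewrite -big_distrr /= sum_words_prod ler_wpM2l ?mulr_ge0 ?sqrtr_ge0 //.
by rewrite lerXn2r ?nnegrE ?sum_rankin_le ?sumr_ge0 // => d _;
  apply: rankin_ge0.
Qed.

End Rankin.

Section BadWords.
Variable R : realType.
Implicit Types (w s : seq nat) (m e : R) (k : subseq_kind) (Q L : nat).

Definition bad_word s m e Q w : bool :=
  ((size w)%:R <= ln (Q%:R : R) / 8) || (e * (size w)%:R <= `|deviation s m w|).

Lemma count_short_words_le Q L : (0 < Q)%N -> L%:R <= ln (Q%:R : R) / 8 ->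
  (count (denom_le R Q) (words Q L))%:R
  <= Q%:R ^+ 2 * expR (- (ln Q%:R / 4)) :> R.
Proof.
move=> Q0 Ll; have Qpos : 0 < Q%:R :> R by rewrite ltr0n.
apply: le_trans (le_trans (_ : _ <= _) (count_words_prod_le R Q L Q)) _.
  rewrite ler_nat; apply: sub_count => w Qw.
  by rewrite (denom_le_prod Q0 Qw) andbT; case/andP: Qw.
set l := ln Q%:R in Ll *; have Ql : Q%:R = expR l by rewrite lnK.
have -> : Num.sqrt Q%:R = expR (l / 2).
  rewrite Ql (_ : expR l = expR (l / 2) ^+ 2).
    by rewrite sqrtr_sqr ger0_norm ?expR_ge0.
  by rewrite -expRM_natr; congr expR; field.
have pow3 : 3 ^+ L <= expR (l / 4).
  apply: (@le_trans _ _ (expR 2 ^+ L)).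
    by rewrite lerXn2r ?nnegrE ?expR_ge0 //; have := expR_ge1Dx (2 : R); lra.
  by rewrite -expRM_natr ler_expR; lra.
apply: le_trans (ler_wpM2l _ pow3) _; first by rewrite mulr_ge0 ?expR_ge0.
by rewrite Ql expr2 -!expRD ler_expR; lra.
Qed.

Lemma count_denom_le_sum (P : pred (seq nat)) Q L : (0 < Q)%N ->
  (count [pred w | P w & denom_le R Q w] (words Q L))%:R <=
  2 * Q%:R ^+ 2 * \sum_(w <- words Q L | P w) word_weight w 0 :> R.
Proof.
move=> Q0; rewrite big_distrr big_mkcond; apply: natr_count_le_sum => w wQ /=.
case: (P w) => //=; case: (boolP (denom_le R Q w)) =>
  [/(denom_le_word_weight Q0)//|_].
by rewrite !mulr_ge0 ?exprn_ge0 ?word_weight_ge0 ?(words_positive wQ)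
  ?lexx ?ler01.
Qed.

Lemma count_bad_words_le s e : (0 < size s)%N -> positive s -> 0 < e <= 1 ->
  exists2 c : R, 0 < c & \forall Q \near \oo, forall L,
   (count [pred w | bad_word s (gauss_mass R s) e Q w & denom_le R Q w]
          (words Q L))%:R
   <= 4 * expR 1 * Q%:R ^+ 2 * expR (- (c * ln Q%:R)).
Proof.
move=> s1 s0 e01; have [c c0 tail] := deviation_large_le s1 s0 e01.
set m := gauss_mass R s in tail *.
exists (Num.min (4^-1) (c / 8));
  first by rewrite lt_min; apply/andP; split; lra.
near=> Q => L; set c' := Num.min _ _.
have Q0 : (0 < Q)%N by near: Q; apply: nbhs_infty_gt.
set l := ln Q%:R; have l0 : 0 <= l by rewrite ln_ge0 // ler1n.
have e1 : 1 <= expR 1 :> R by rewrite -[leLHS]expR0 ler_expR.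
have [Ll|lL] := leP L%:R (l / 8).
  apply: le_trans (le_trans (_ : _ <= _) (count_short_words_le Q0 Ll)) _.
    by rewrite ler_nat; apply: sub_count => w /andP[].
  rewrite -mulrA -[leLHS]mul1r; apply: ler_pM => //; first by lra.
  rewrite ler_wpM2l ?exprn_ge0 // ler_expR lerN2 mulrC ler_wpM2l //.
  by rewrite ge_min lexx.
have -> : count [pred w | bad_word s m e Q w & denom_le R Q w] (words Q L) =
    count [pred w | e * L%:R <= `|deviation s m w| & denom_le R Q w]
          (words Q L).
  apply: eq_in_count => w wQ /=.
  by rewrite /bad_word (words_size wQ) -/l leNgt lL.
apply: le_trans (count_denom_le_sum _ _ Q0) _.
have tailQ : forall L x, 0 <= x <= 1 ->
    \sum_(w <- words Q L | e * L%:R <= `|deviation s m w|) word_weight w x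
    <= 2 * expR (1 - c * L%:R) by near: Q.
apply: le_trans (ler_wpM2l _ (tailQ L 0 _)) _;
  rewrite ?mulr_ge0 ?exprn_ge0 ?lexx ?ler01 //.
rewrite expRD [leLHS](_ : _ = 4 * expR 1 * Q%:R ^+ 2 * expR (- (c * L%:R)));
  last by ring.
rewrite ler_wpM2l ?mulr_ge0 ?expR_ge0 ?exprn_ge0 // ler_expR lerN2.
apply: (@le_trans _ _ (c / 8 * l)); last by nra.
by rewrite ler_wpM2r // ge_min lexx orbT.
Unshelve. all: by end_near. Qed.

Lemma count_rat_words_le (P : pred (seq nat)) k Q N : (0 < Q)%N ->
  4 * ln (Q%:R : R) + 1 < N%:R ->
  (count P (rat_words R k Q) <=
   \sum_(0 <= L < N) count [pred w | P w & denom_le R Q w] (words Q L))%N.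
Proof.
move=> Q0 QN; set T := [pred w | P w & denom_le R Q w].
have -> : (\sum_(0 <= L < N) count T (words Q L))%N =
    size (flatten [seq [seq w <- words Q L | T w] | L <- iota 0 N]).
  rewrite size_flatten sumnE !big_map /index_iota subn0.
  by apply: eq_bigr => L _; rewrite size_filter.
rewrite -size_filter; apply: uniq_leq_size => [|w].
  exact: filter_uniq (rat_words_uniq R k Q).
rewrite mem_filter => /andP[Pw /mem_rat_words[Qw _]]; apply/flattenP.
exists [seq w <- words Q (size w) | T w];
  last by rewrite mem_filter /= Pw Qw (denom_le_words Q0 Qw).
apply: map_f; rewrite mem_iota /= add0n -(ltr_nat R).
exact: le_lt_trans (denom_le_size Q0 Qw) QN.
Qed.

Lemma count_bad_rat_words_le s e : (0 < size s)%N -> positive s -> 0 < e <= 1 ->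
  exists2 c : R, 0 < c & \forall Q \near \oo, forall k,
   (count (bad_word s (gauss_mass R s) e Q) (rat_words R k Q))%:R <=
   (4 * ln Q%:R + 2) * (4 * expR 1 * Q%:R ^+ 2 * expR (- (c * ln Q%:R))).
Proof.
move=> s1 s0 e01; have [c c0 per_length] := count_bad_words_le s1 s0 e01.
set m := gauss_mass R s in per_length *; exists c => //; near=> Q => k.
have Q0 : (0 < Q)%N by near: Q; apply: nbhs_infty_gt.
have l0 : 0 <= ln Q%:R :> R by rewrite ln_ge0 // ler1n.
set N := (Num.truncn (4 * ln (Q%:R : R) + 1)).+1.
have QN : 4 * ln (Q%:R : R) + 1 < N%:R by apply: truncnS_gt.
have := count_rat_words_le (bad_word s m e Q) k Q0 QN.
rewrite -(ler_nat R) natr_sum => /le_trans; apply.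
have per_lengthQ : forall L,
   (count [pred w | bad_word s m e Q w & denom_le R Q w] (words Q L))%:R
   <= 4 * expR 1 * Q%:R ^+ 2 * expR (- (c * ln Q%:R)) by near: Q.
apply: le_trans (ler_sum _ (fun L _ => per_lengthQ L)) _.
rewrite sumr_const_nat subn0 -[_ *+ N]mulr_natl ler_wpM2r //.
have : (Num.truncn (4 * ln (Q%:R : R) + 1))%:R <= 4 * ln (Q%:R : R) + 1.
  by rewrite truncn_le; lra.
by rewrite /N -natr1; lra.
Unshelve. all: by end_near. Qed.

Lemma count_bad_rat_words_negligible s e (eta : R) : (0 < size s)%N ->
  positive s ->
  0 < e <= 1 -> 0 < eta -> \forall Q \near \oo, forall k,
   (count (bad_word s (gauss_mass R s) e Q) (rat_words R k Q))%:R * ln Q%:R ^+ 2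
    <= eta * Q%:R ^+ 2.
Proof.
move=> s1 s0 e01 eta0; have [c c0 count_le] := count_bad_rat_words_le s1 s0 e01.
set K := 4 * expR 1 : R; have K0 : 0 < K by rewrite mulr_gt0 ?expR_gt0.
near=> Q => k.
have l1 : 1 <= ln Q%:R :> R by near: Q; apply: near_ln_ge.
have lK : 144 * K / c ^+ 4 / eta <= ln Q%:R by near: Q; apply: near_ln_ge.
have countQ : forall k,
  (count (bad_word s (gauss_mass R s) e Q) (rat_words R k Q))%:R
  <= (4 * ln Q%:R + 2) * (K * Q%:R ^+ 2 * expR (- (c * ln Q%:R))) by near: Q.
set l := ln Q%:R in l1 lK countQ *.
have cl0 : 0 < c * l by rewrite mulr_gt0 //; lra.
have Q2 : 0 <= Q%:R ^+ 2 :> R by rewrite exprn_ge0.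
apply: le_trans (ler_wpM2r (sqr_ge0 l) (countQ k)) _.
apply: (@le_trans _ _ (6 * l * (K * Q%:R ^+ 2 * (24 / (c * l) ^+ 4)) * l ^+ 2)).
  rewrite ler_wpM2r ?sqr_ge0 //; apply: ler_pM; first by lra.
  - by rewrite !mulr_ge0 ?expR_ge0 // ltW.
  - by lra.
  by rewrite ler_wpM2l ?expRN_le_invX4 // mulr_ge0 // ltW.
rewrite (_ : _ * l ^+ 2 = 144 * K / c ^+ 4 / l * Q%:R ^+ 2); last first.
  by field; apply/andP; split; lra.
rewrite ler_wpM2r // ler_pdivrMr; last by lra.
by rewrite [leRHS]mulrC -ler_pdivrMr.
Unshelve. all: by end_near. Qed.

End BadWords.

(** * Chebyshev's lower bound *)

Definition prime_count (n : nat) : nat := count prime (iota 1 n).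

Lemma prime_countS n : prime_count n.+1 = (prime_count n + prime n.+1)%N.
Proof.
by rewrite /prime_count -[n.+1]addn1 iotaD count_cat /= addn0 add1n addn1.
Qed.

Lemma leq_prime_count m n : (m <= n)%N -> (prime_count m <= prime_count n)%N.
Proof.
by move=> mn; rewrite -(subnKC mn) /prime_count iotaD count_cat leq_addr.
Qed.

Lemma bin_double_fact m : ('C(2 * m, m) * (m`! * m`!))%N = (2 * m)`!.
Proof. by rewrite -(@bin_fact (2 * m) m) ?mul2n -?addnn ?leq_addr ?addnK. Qed.

Lemma expn2_le_bin_double m : (2 ^ m <= 'C(2 * m, m))%N.
Proof.
rewrite -(@leq_pmul2r (m`! * m`!)) ?muln_gt0 ?fact_gt0 // bin_double_fact.
elim: m => // m IH; rewrite mulnS !factS expnS [leqRHS]mulnA.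
apply: leq_trans (leq_mul (leqnn _) IH).
rewrite (_ : 2 * 2 ^ m * _ = (2 * m.+1 * m.+1) * (2 ^ m * (m`! * m`!)))%N;
  last by ring.
by rewrite leq_mul2r; apply/orP; right; nia.
Qed.

Lemma sum_leq_le N e : (\sum_(1 <= k < N.+1) (k <= e) <= e)%N.
Proof.
suff : (\sum_(1 <= k < N.+1) (k <= e) <= minn N e)%N.
  by move/leq_trans; apply; rewrite geq_minr.
elim: N => [|N IH]; first by rewrite big_geq.
rewrite big_nat_recr //=; lia.
Qed.

Lemma logn_fact_widen p m N : prime p -> (m <= N)%N ->
  logn p m`! = (\sum_(1 <= k < N.+1) m %/ p ^ k)%N.
Proof.
move=> pp mN; rewrite logn_fact // [RHS](big_cat_nat (n := m.+1)) //=.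
rewrite [X in (_ + X)%N]big_nat_cond [X in (_ + X)%N]big1 ?addn0 // => k.
move=> /andP[/andP[mk _] _]; rewrite divn_small //.
exact: ltn_trans mk (ltn_expl k (prime_gt1 pp)).
Qed.

Lemma logn_bin_double_le p m : prime p ->
  (logn p 'C(2 * m, m) <= trunc_log p (2 * m))%N.
Proof.
move=> pp; have m2m : (m <= 2 * m)%N by rewrite leq_pmull.
have := congr1 (logn p) (bin_double_fact m).
rewrite lognM ?muln_gt0 ?fact_gt0 ?bin_gt0 // lognM ?fact_gt0 //.
rewrite !(@logn_fact_widen p _ (2 * m)) // -big_split /=.
have carry : (\sum_(1 <= k < (2 * m).+1) 2 * m %/ p ^ k <=
    \sum_(1 <= k < (2 * m).+1)
      (m %/ p ^ k + m %/ p ^ k + (k <= trunc_log p (2 * m))))%N.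
  apply: leq_sum => k _; rewrite {1}mul2n -addnn divnD ?expn_gt0 ?prime_gt0 //.
  rewrite leq_add2l; case: (leqP (p ^ k) _) => // pk_le.
  rewrite trunc_log_max ?prime_gt1 // (leq_trans pk_le) // mul2n -addnn.
  by rewrite leq_add ?leq_mod.
move: carry; rewrite big_split /=.
have := sum_leq_le (2 * m) (trunc_log p (2 * m)); lia.
Qed.

Lemma bin_double_le_expn_prime_count m : (0 < m)%N ->
  ('C(2 * m, m) <= (2 * m) ^ prime_count (2 * m))%N.
Proof.
move=> m0; have C0 : (0 < 'C(2 * m, m))%N by rewrite bin_gt0; lia.
rewrite {1}(prod_prime_decomp C0) prime_decompE big_map /=.
apply: (@leq_trans ((2 * m) ^ size (primes 'C(2 * m, m)))).
  rewrite -iter_muln_1 -count_predT -big_const_seq big_seq [leqRHS]big_seq.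
  apply: leq_prod => p; rewrite mem_primes => /and3P[pp _ _].
  apply: leq_trans (trunc_logP (prime_gt1 pp) _); last by lia.
  by rewrite leq_exp2l ?prime_gt1 // logn_bin_double_le.
rewrite leq_pexp2l //; first by lia.
rewrite /prime_count -size_filter uniq_leq_size ?primes_uniq // => p p_in.
have pp : prime p by move: p_in; rewrite mem_primes => /and3P[].
rewrite mem_filter pp mem_iota prime_gt0 //= add1n ltnS.
have : (0 < trunc_log p (2 * m))%N.
  by apply: leq_trans (logn_bin_double_le m pp); rewrite logn_gt0.
by rewrite trunc_log_gt0 => /andP[_]; have := prime_gt0 pp; lia.
Qed.

Lemma bin_prime_count_le_size_rats k Q :
  ('C(prime_count Q, 2) <= size (rats k Q))%N.
Proof.
case: Q => // -[//|Q]; elim: Q => [//|Q IH].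
rewrite rats_recr size_cat prime_countS size_map size_filter.
case: (boolP (prime Q.+3)) => pQ; last first.
  by rewrite addn0; apply: leq_trans IH _; rewrite leq_addr.
rewrite addn1 binS bin1 leq_add //.
rewrite /prime_count (@eq_in_count _ _ (fun p => prime p && (p < Q.+3)%N));
  last first.
  by move=> p; rewrite mem_iota add1n => /andP[_ ->]; rewrite andbT.
apply: sub_count => p /andP[pp pQ'].
have cpQ : coprime p Q.+3 by rewrite prime_coprime // dvdn_prime2 // ltn_eqF.
by rewrite cpQ /=; case: k {IH} => //=; rewrite ?pp ?pQ.
Qed.

Section NumberOfRationals.
Variable R : realType.
Implicit Types (k : subseq_kind) (Q : nat).

Lemma prime_count_ge Q : (1 < Q)%N ->
  Q%:R / 6 <= (prime_count Q)%:R * ln Q%:R :> R.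
Proof.
move=> Q1; set m := Q./2.
have m0 : (0 < m)%N by rewrite /m; lia.
have mQ : (2 * m <= Q)%N by rewrite /m; lia.
have Qm : (Q <= 3 * m)%N by rewrite /m; lia.
have pow_le : (2 ^ m <= Q ^ prime_count Q)%N.
  apply: leq_trans (expn2_le_bin_double m) _.
  apply: leq_trans (bin_double_le_expn_prime_count m0) _.
  apply: (@leq_trans (Q ^ prime_count (2 * m))).
    by case: (prime_count (2 * m)) => // n; rewrite leq_exp2r.
  by rewrite leq_pexp2l ?leq_prime_count // ltnW.
have Q0 : 0 < Q%:R :> R by rewrite ltr0n ltnW.
have : ln (2 ^ m)%N%:R <= ln (Q ^ prime_count Q)%N%:R :> R.
  by rewrite ler_ln ?posrE ?ltr0n ?expn_gt0 ?ler_nat // ltnW.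
rewrite !natrX !lnXn // -[ln 2 *+ _]mulr_natl -[ln Q%:R *+ _]mulr_natl.
apply: le_trans; have ln2_half := ln2_ge_half R.
have : Q%:R <= 3 * m%:R :> R by rewrite -natrM ler_nat.
have : 0 <= m%:R :> R by [].
nra.
Qed.

Lemma sqr_le_size_rats k Q : (2 < Q)%N ->
  Q%:R ^+ 2 <= 144 * (size (rats k Q))%:R * ln Q%:R ^+ 2 :> R.
Proof.
move=> Q2; have Q1 : (1 < Q)%N by apply: ltnW.
have pi2 : (2 <= prime_count Q)%N.
  by rewrite -[2%N]/(prime_count 3) leq_prime_count.
have pi_sqr : (prime_count Q * prime_count Q <= 4 * size (rats k Q))%N.
  have := bin_prime_count_le_size_rats k Q.
  by have := mul_bin_diag (prime_count Q) 1; rewrite bin1; nia.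
have {}pi_sqr : (prime_count Q)%:R ^+ 2 <= 4 * (size (rats k Q))%:R :> R.
  by rewrite expr2 -!natrM ler_nat.
have l0 : 0 <= ln Q%:R :> R by rewrite ln_ge0 // ler1n ltnW.
have : (Q%:R / 6) ^+ 2 <= ((prime_count Q)%:R * ln Q%:R) ^+ 2 :> R.
  by rewrite lerXn2r ?nnegrE ?divr_ge0 ?mulr_ge0 ?prime_count_ge.
have := ler_wpM2r (exprn_ge0 2 l0) pi_sqr.
by rewrite !exprMn; lra.
Qed.

Lemma sqrS_le_size_rats k Q : (2 < Q)%N ->
  Q.+1%:R ^+ 2 <= 576 * (size (rats k Q))%:R * ln Q.+1%:R ^+ 2 :> R.
Proof.
move=> Q2; have Q0 : (0 < Q)%N by apply: ltn_trans Q2.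
have ln_mono : ln (Q%:R : R) <= ln Q.+1%:R.
  by rewrite ler_ln ?posrE ?ltr0n ?ler_nat.
have l0 : 0 <= ln (Q%:R : R) by rewrite ln_ge0 // ler1n.
have sqr_ln_mono : ln (Q%:R : R) ^+ 2 <= ln Q.+1%:R ^+ 2.
  by rewrite lerXn2r ?nnegrE ?(le_trans l0 ln_mono).
have : Q.+1%:R ^+ 2 <= (2 * Q%:R) ^+ 2 :> R.
  rewrite lerXn2r ?nnegrE ?mulr_ge0 // -natrM ler_nat; lia.
have := sqr_le_size_rats k Q2.
have := ler_wpM2l (ler0n R (size (rats k Q))) sqr_ln_mono.
by rewrite exprMn; lra.
Qed.

Lemma natrS_le_size_rats k Q : (2 < Q)%N ->
  Q.+1%:R <= 1152 * (size (rats k Q))%:R :> R.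
Proof.
move=> Q2; have Q0 : 0 < Q.+1%:R :> R by rewrite ltr0n.
have sqr_ln : ln Q.+1%:R ^+ 2 <= 2 * Q.+1%:R :> R
  by apply: sqr_ln_le; rewrite ler1n.
rewrite -(ler_pM2r Q0) -expr2; apply: le_trans (sqrS_le_size_rats k Q2) _.
by have := ler_wpM2l (ler0n R (size (rats k Q))) sqr_ln; lra.
Qed.

End NumberOfRationals.

(** * Frequencies in the concatenation *)

Section Occurrences.
Variable R : realType.
Implicit Types (x m : R) (w s : seq nat) (d : nat -> nat) (p : nat).

Definition starts_at d p w : Prop :=
  forall j, (j < size w)%N -> d (p + j)%N = nth 0%N w j.

Definition occurs_at d s i : bool :=
  all (fun j => d (i + j)%N == nth 0%N s j) (iota 0 (size s)).

Definition occ_deviation d s m a b : R :=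
  \sum_(a <= i < b) ((occurs_at d s i)%:R - m).

Lemma starts_at_cat d p w1 w2 : starts_at d p (w1 ++ w2) ->
  starts_at d p w1 /\ starts_at d (p + size w1) w2.
Proof.
move=> dw; split=> j jw.
  by rewrite dw ?nth_cat ?jw // size_cat ltn_addr.
by rewrite -addnA dw ?nth_cat ?ltnNge ?leq_addr ?addKn //
  size_cat -ltnNge ltn_add2l.
Qed.

Lemma occurs_at_prefix d s w p i : (i + size s <= size w)%N ->
  starts_at d p w ->
  occurs_at d s (p + i) = prefix s (drop i w).
Proof.
move=> isw dw; rewrite prefixE.
have size_take_drop : size (take (size s) (drop i w)) = size s.
  by rewrite size_takel // size_drop; lia.
apply/allP/eqP => [ds|ws j].
  apply: (@eq_from_nth _ 0%N) => // j; rewrite size_take_drop => js.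
  rewrite nth_take // nth_drop -dw; last by lia.
  by rewrite addnA; apply/eqP; apply: ds; rewrite mem_iota.
rewrite mem_iota => /andP[_ js]; rewrite -addnA dw; last by lia.
by rewrite -nth_drop -(nth_take 0%N (n0 := size s)) ?ws //; lia.
Qed.

Lemma normr_occ_deviation_le d s m a b : 0 <= m <= 1 ->
  `|occ_deviation d s m a b| <= (b - a)%:R.
Proof.
move=> /andP[m0 m1]; apply: le_trans (ler_norm_sum _ _ _) _.
rewrite -[leRHS]mulr1 mulr_natl -sumr_const_nat.
by apply: ler_sum => i _; rewrite ler_norml; case: occurs_at => /=; lra.
Qed.

(* Only the occurrences overlapping the end of [w] are counted differently. *)
Lemma occ_deviation_word_le d s m w p : starts_at d p w ->
  `|occ_deviation d s m p (p + size w) - deviation s m w| <= (size s)%:R.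
Proof.
move=> dw; rewrite /occ_deviation /deviation -{1}[p]add0n big_addn addKn -sumrB.
set n := size w; set k := size s.
rewrite (big_cat_nat (n := (n - k)%N)) //=; last by rewrite leq_subr.
rewrite big_nat_cond [X in `|X + _|]big1 ?add0r; last first.
  move=> i /andP[/andP[_ ink] _].
  rewrite addnC /centered (occurs_at_prefix _ dw) ?subrr //;
    rewrite -/n -/k; lia.
apply: le_trans (ler_norm_sum _ _ _) _.
apply: (@le_trans _ _ (\sum_(n - k <= i < n) 1)).
  apply: ler_sum => i _; rewrite /centered ler_norml.
  by case: occurs_at; case: prefix => /=; lra.
by rewrite sumr_const_nat ler_nat; lia.
Qed.

Lemma occ_deviation_flatten_le d s m ws p : starts_at d p (flatten ws) ->
  `|occ_deviation d s m p (p + size (flatten ws)) -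
    \sum_(w <- ws) deviation s m w|
  <= (size s * size ws)%:R.
Proof.
elim: ws p => [|w ws IH] p /=.
  by move=> _; rewrite /occ_deviation addn0 big_geq // big_nil subrr normr0.
move=> /starts_at_cat[dw dws]; rewrite /occ_deviation size_cat addnA.
rewrite (big_cat_nat (n := (p + size w)%N))
  ?leq_addr //= big_cons opprD addrACA.
apply: le_trans (ler_normD _ _) _; rewrite mulnS natrD.
by apply: lerD; [exact: occ_deviation_word_le | exact: IH].
Qed.

Lemma size_flatten_sum (ws : seq (seq nat)) :
  (size (flatten ws))%:R = \sum_(w <- ws) (size w)%:R :> R.
Proof. by rewrite size_flatten sumnE big_map natr_sum. Qed.

Lemma flatten_take_le (ws : seq (seq nat)) N (B : R) :
  {in ws, forall w, (size w)%:R <= B} -> 0 <= B -> (N <= size (flatten ws))%N ->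
  exists T, (size (flatten (take T ws)) <= N)%N /\
    N%:R <= (size (flatten (take T ws)))%:R + B.
Proof.
elim: ws N => [|w ws IH] N wsB B0 /=.
  by rewrite leqn0 => /eqP ->; exists 0%N; rewrite add0r.
rewrite size_cat => Nw; have [wN|Nw1] := leqP (size w) N; last first.
  exists 0%N; split => //; rewrite add0r;
    apply: le_trans (wsB w (mem_head _ _)).
  by rewrite ler_nat ltnW.
have tailB : {in ws, forall v, (size v)%:R <= B}.
  by move=> v vws; apply: wsB; rewrite inE vws orbT.
have [|T [TN NT]] := IH (N - size w)%N tailB B0; first by lia.
exists T.+1; rewrite /= size_cat natrD; split; first by lia.
by move: NT; rewrite natrB //; lra.
Qed.

Lemma sum_deviation_le s m (e B : R) Q (ws : seq (seq nat)) : 0 <= m <= 1 ->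
  0 <= e ->
  {in ws, forall w, (size w)%:R <= B} ->
  `|\sum_(w <- ws) deviation s m w| <=
  e * (size (flatten ws))%:R + (count (bad_word s m e Q) ws)%:R * B.
Proof.
move=> m01 e0 wsB; apply: le_trans (ler_norm_sum _ _ _) _.
rewrite size_flatten_sum -sum1_count natr_sum [X in _ + X * _]big_mkcond /=.
rewrite big_distrr big_distrl -big_split /= big_seq [leRHS]big_seq.
apply: ler_sum => w ww; case: ifP => [_|].
  rewrite mul1r.
  apply: le_trans (le_trans (normr_deviation_le s w m01) (wsB w ww)) _.
  by rewrite lerDr mulr_ge0.
by rewrite /bad_word mul0r addr0 => /norP[_]; rewrite -ltNge => /ltW.
Qed.

Lemma occ_deviation_words_le d s m (e B : R) Q (vs : seq (seq nat)) N :
  0 <= m <= 1 -> 0 <= e -> {in vs, forall w, (size w)%:R <= B} ->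
  starts_at d 0 (flatten vs) -> (size (flatten vs) <= N)%N ->
  N%:R <= (size (flatten vs))%:R + B ->
  `|occ_deviation d s m 0 N| <= (size s)%:R * (size vs)%:R +
    (e * (size (flatten vs))%:R + (count (bad_word s m e Q) vs)%:R * B) + B.
Proof.
move=> m01 e0 vsB dvs; set n := size (flatten vs) => nN Nn.
rewrite /occ_deviation (big_cat_nat _ nN) //= -/(occ_deviation d s m 0 n).
rewrite -/(occ_deviation d s m n N); apply: le_trans (ler_normD _ _) _.
apply: lerD; last first.
  apply: le_trans (normr_occ_deviation_le _ _ _ _ m01) _.
  by rewrite natrB // lerBlDl.
rewrite -[occ_deviation d s m 0 n](subrK (\sum_(w <- vs) deviation s m w)).
apply: le_trans (ler_normD _ _) _; rewrite -natrM.
apply: lerD; first exact: occ_deviation_flatten_le.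
exact: sum_deviation_le.
Qed.

Lemma size_flatten_ge s m (e : R) Q (ws : seq (seq nat)) : 0 <= ln (Q%:R : R) ->
  ((size ws)%:R - (count (bad_word s m e Q) ws)%:R) * (ln Q%:R / 8) <=
  (size (flatten ws))%:R :> R.
Proof.
move=> l0; rewrite size_flatten_sum -(count_predC (bad_word s m e Q) ws) natrD
  addrAC.
rewrite subrr add0r -sum1_count natr_sum big_mkcond /= big_distrl /=.
apply: ler_sum => w _; case: ifP => good; last by rewrite mul0r ler0n.
by move: good; rewrite /bad_word mul1r => /norP[]; rewrite -ltNge => /ltW.
Qed.

Lemma occE d s N x : has_cf x d ->
  (occ s N x)%:R = \sum_(0 <= i < N) (occurs_at d s i)%:R :> R.
Proof.
move=> [_ dx]; rewrite /occ -[1%N]addn0 iotaDl count_map.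
rewrite (@eq_count _ _ (occurs_at d s)); last first.
  by move=> i; apply: eq_all => j; rewrite add1n addSn dx.
rewrite -sum1_count natr_sum /index_iota subn0 big_mkcond /=.
by apply: eq_bigr => i _; case: occurs_at.
Qed.

End Occurrences.

Section Concatenation.
Variable R : realType.
Implicit Types (x e : R) (s w : seq nat) (d : nat -> nat).
Implicit Types (k : subseq_kind) (Q N : nat).

Lemma leq_size_concat_prefix k Q Q' : (Q <= Q')%N ->
  (size (concat_prefix R k Q) <= size (concat_prefix R k Q'))%N.
Proof.
move=> /(rat_words_prefix R k)[l prefix_l].
by rewrite !concat_prefixE prefix_l flatten_cat size_cat leq_addr.
Qed.

Lemma size_rats_le_concat_prefix k Q :
  (size (rats k Q) <= size (concat_prefix R k Q))%N.
Proof.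
rewrite concat_prefixE -(size_rat_words R) size_flatten sumnE big_map
  -sum1_size.
rewrite big_seq [leqRHS]big_seq; apply: leq_sum => w.
by move=> /mem_rat_words[].
Qed.

Lemma concat_prefix_unbounded k N :
  exists Q, (N < size (concat_prefix R k Q))%N.
Proof.
exists (1152 * N).+3; apply: leq_trans (size_rats_le_concat_prefix _ _).
have := @natrS_le_size_rats R k (1152 * N).+3 isT; rewrite -natrM ler_nat; lia.
Qed.

Lemma near_size_rats_ge (A : R) :
  \forall Q \near \oo, forall k, A <= (size (rats k Q))%:R.
Proof.
near=> Q => k; have Q2 : (2 < Q)%N by near: Q; apply: nbhs_infty_gt.
have AQ : 1152 * A <= Q%:R by near: Q; apply: nbhs_infty_ger.
have := natrS_le_size_rats R k Q2; rewrite -natr1; lra.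
Unshelve. all: by end_near. Qed.

Lemma near_count_bad_le_size_rats s (e delta : R) : (0 < size s)%N ->
  positive s ->
  0 < e <= 1 -> 0 < delta -> \forall Q \near \oo, forall k,
  (count (bad_word s (gauss_mass R s) e Q.+1) (rat_words R k Q.+1))%:R
  <= delta * (size (rats k Q))%:R.
Proof.
move=> s1 s0 e01 delta0; have eta0 : 0 < delta / 576 by lra.
have /near_inftyS negligible := count_bad_rat_words_negligible s1 s0 e01 eta0.
near=> Q => k; have Q2 : (2 < Q)%N by near: Q; apply: nbhs_infty_gt.
have ln0 : 0 < ln Q.+1%:R ^+ 2 :> R.
  by rewrite exprn_gt0 // ln_gt0 // ltr1n; lia.
rewrite -(ler_pM2r ln0); apply: (@le_trans _ _ (delta / 576 * Q.+1%:R ^+ 2)).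
  by move: k; near: Q.
apply: le_trans (ler_wpM2l (ltW eta0) (sqrS_le_size_rats R k Q2)) _.
lra.
Unshelve. all: by end_near. Qed.

Lemma concat_prefix_words k d N Q : is_concat R k d ->
  (size (concat_prefix R k Q) <= N)%N ->
  (N < size (concat_prefix R k Q.+1))%N ->
  exists vs us, [/\ rat_words R k Q.+1 = vs ++ us,
    (size (rats k Q) <= size vs)%N, (size (flatten vs) <= N)%N,
    N%:R <= (size (flatten vs))%:R + (4 * ln Q.+1%:R + 1) :> R
    & starts_at d 0 (flatten vs)].
Proof.
move=> dc QN NQ; have [l rat_words_l] := rat_words_prefix R k (leqnSn Q).
have dQ : starts_at d 0 (flatten (rat_words R k Q.+1)).
  by move=> j; rewrite -concat_prefixE; apply: dc.
rewrite !concat_prefixE rat_words_l flatten_cat size_cat in QN NQ.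
set n := size (flatten (rat_words R k Q)) in QN NQ.
have lB : {in l, forall w, (size w)%:R <= 4 * ln Q.+1%:R + 1 :> R}.
  move=> w wl; have : w \in rat_words R k Q.+1
    by rewrite rat_words_l mem_cat wl orbT.
  by move=> /mem_rat_words[/denom_le_size -> //].
have B0 : 0 <= 4 * ln Q.+1%:R + 1 :> R
  by rewrite addr_ge0 ?mulr_ge0 ?ln_ge0 ?ler1n.
have [|T [TN NT]] := @flatten_take_le R l (N - n) _ lB B0; first by lia.
exists (rat_words R k Q ++ take T l), (drop T l).
have split_T : rat_words R k Q.+1 = (rat_words R k Q ++ take T l) ++ drop T l.
  by rewrite -catA cat_take_drop.
split => //.
- by rewrite size_cat size_rat_words leq_addr.
- by rewrite flatten_cat size_cat -/n -(subnKC QN) leq_add2l.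
- by rewrite flatten_cat size_cat -/n natrD; move: NT; rewrite natrB //; lra.
- by move: dQ; rewrite split_T flatten_cat => /starts_at_cat[].
Qed.

Lemma window_error_le (e z v l b n : R) : 0 < e <= 1 -> 1 <= l ->
  16 * z <= l * e ->
  80 <= v * e -> 0 <= b -> b <= e / 160 * v -> (v - b) * (l / 8) <= n ->
  z * v + (e * n + b * (4 * l + 1)) + (4 * l + 1) <= 4 * e * n.
Proof.
move=> /andP[e0 e1] l1 zl ve b0 bv n_ge.
have v0 : 0 < v by rewrite -(pmulr_lgt0 _ e0); lra.
have vl_le : v * l / 16 <= n.
  have : b <= v / 2 by nra.
  nra.
have boundary : z * v <= e * (v * l / 16).
  have := ler_wpM2l (ltW v0) zl; lra.
have last_word : 4 * l + 1 <= e * (v * l / 16).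
  have : 80 * l <= v * e * l by rewrite ler_wpM2r //; lra.
  lra.
have bad_words : b * (4 * l + 1) <= e * (v * l / 16).
  apply: (@le_trans _ _ (e / 160 * v * (5 * l))); last by nra.
  by apply: ler_pM => //; lra.
have := ler_wpM2l (ltW e0) vl_le; lra.
Qed.

Lemma near_occ_deviation_window_le s e : (0 < size s)%N -> positive s ->
  0 < e <= 1 ->
  \forall Q \near \oo, forall k d N, is_concat R k d ->
  (size (concat_prefix R k Q) <= N)%N ->
  (N < size (concat_prefix R k Q.+1))%N ->
  `|occ_deviation d s (gauss_mass R s) 0 N| <= 4 * e * N%:R.
Proof.
move=> s1 s0 e01; have /andP[e0 e1] := e01; have m01 := gauss_mass_itv R s0.
set m := gauss_mass R s in m01 *; have delta0 : 0 < e / 160 by lra.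
have few_bad := near_count_bad_le_size_rats s1 s0 e01 delta0.
rewrite -/m in few_bad.
have near_lnS (A : R) : \forall n \near \oo, A <= ln n.+1%:R.
  exact: near_inftyS (near_ln_ge A).
near=> Q => k d N dc QN NQ.
have l1 : 1 <= ln Q.+1%:R :> R by near: Q; apply: near_lnS.
have lz : 16 * (size s)%:R / e <= ln Q.+1%:R by near: Q; apply: near_lnS.
have many : 80 / e <= (size (rats k Q))%:R.
  by move: k {dc QN NQ}; near: Q; apply: near_size_rats_ge.
have bad_le : (count (bad_word s m e Q.+1) (rat_words R k Q.+1))%:R
    <= e / 160 * (size (rats k Q))%:R by move: k {dc QN NQ many}; near: Q.
have [vs [us [vsQ vs_ge nN Nn dvs]]] := concat_prefix_words dc QN NQ.
rewrite -(ler_nat R) in vs_ge.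
set n := size (flatten vs) in nN Nn; set l := ln Q.+1%:R in l1 lz Nn.
have vsB : {in vs, forall w, (size w)%:R <= 4 * l + 1 :> R}.
  move=> w wvs; have : w \in rat_words R k Q.+1 by rewrite vsQ mem_cat wvs.
  by move=> /mem_rat_words[/denom_le_size -> //].
apply: (@le_trans _ _ (4 * e * n%:R));
  last by rewrite ler_wpM2l ?ler_nat ?mulr_ge0 ?ltW.
apply: le_trans (window_error_le (z := (size s)%:R) (v := (size vs)%:R)
  (b := (count (bad_word s m e Q.+1) vs)%:R) e01 l1 _ _ _ _
  (size_flatten_ge _ _ _ _ _)).
- exact: occ_deviation_words_le (ltW e0) vsB dvs nN Nn.
- by rewrite -ler_pdivrMr.
- by rewrite -ler_pdivrMr //; apply: le_trans vs_ge.
- by [].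
- apply: le_trans (le_trans (_ : _ <= _) bad_le) _.
    by rewrite ler_nat vsQ count_cat leq_addr.
  by rewrite ler_wpM2l // ltW.
- by apply: le_trans l1.
Unshelve. all: by end_near. Qed.

Lemma near_occ_deviation_le k s e : (0 < size s)%N -> positive s ->
  0 < e <= 1 ->
  \forall N \near \oo, forall d, is_concat R k d ->
  `|occ_deviation d s (gauss_mass R s) 0 N| <= 4 * e * N%:R.
Proof.
move=> s1 s0 e01; have [Q0 _ window] := near_occ_deviation_window_le s1 s0 e01.
exists (size (concat_prefix R k Q0)) => // N /= Q0N d dc.
have [[|Q] NQ Qmin] := ex_minnP (concat_prefix_unbounded k N); first by [].
have QN : (size (concat_prefix R k Q) <= N)%N.
  by rewrite leqNgt; apply/negP => /Qmin; rewrite ltnn.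
apply: (window Q _ k d N dc QN NQ); rewrite /= leqNgt; apply/negP => QQ0.
have := leq_size_concat_prefix k QQ0.
by rewrite leqNgt (leq_ltn_trans Q0N NQ).
Qed.

Lemma occ_cvg k d s x : is_concat R k d -> has_cf x d -> (0 < size s)%N ->
  positive s -> (fun N => (occ s N x)%:R / N%:R : R) @ \oo --> gauss_mass R s.
Proof.
move=> dc dx s1 s0; apply/cvgrPdist_le => e e0.
set e' := Num.min 1 (e / 4).
have e'01 : 0 < e' <= 1 by rewrite /e' lt_min ge_min lexx ltr01 /= andbT; lra.
have e'e : 4 * e' <= e by rewrite mulrC -ler_pdivlMr // ge_min lexx orbT.
have deviation_le := near_occ_deviation_le k s1 s0 e'01.
near=> N; have N0 : 0 < N%:R :> R.
  by rewrite ltr0n; near: N; apply: nbhs_infty_gt.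
have : `|occ_deviation d s (gauss_mass R s) 0 N| <= 4 * e' * N%:R.
  by move: d {dx} dc; near: N.
rewrite /occ_deviation sumrB -(occE s N dx) sumr_const_nat subn0 distrC.
rewrite -[gauss_mass R s *+ N]mulr_natr.
rewrite (_ : _ - _ = (gauss_mass R s - (occ s N x)%:R / N%:R) * N%:R);
  last by field; rewrite gt_eqF.
rewrite normrM [`|N%:R|]gtr0_norm // ler_pM2r // => /le_trans; exact.
Unshelve. all: by end_near. Qed.

End Concatenation.

(** * The Gauss measure of a cylinder *)

Section Irrationals.
Variable R : realType.
Implicit Types (x y u v : R) (a n : nat) (s : seq nat).

Lemma irrational_neq_nat x n : irrational x -> x != n%:R.
Proof.
by move=> ix; apply/eqP => xn; apply: ix; exists n%:R => //; rewrite ratr_nat.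
Qed.

Lemma irrationalV x : irrational x -> irrational x^-1.
Proof.
move=> ix [q _ qx]; apply: ix; exists q^-1 => //.
by rewrite fmorphV /= qx invrK.
Qed.

Lemma irrational_subn x n : irrational x -> irrational (x - n%:R).
Proof.
move=> ix [q _ qx]; apply: ix; exists (q + n%:R) => //.
by rewrite rmorphD /= qx ratr_nat subrK.
Qed.

Lemma irrational_gauss x : irrational x -> irrational (gauss x).
Proof.
move=> ix; rewrite /gauss (negbTE (irrational_neq_nat 0 ix)).
exact: irrational_subn (irrationalV ix).
Qed.

Lemma gauss_itv x : 0 < x -> 0 <= gauss x < 1.
Proof.
move=> x0; rewrite /gauss gt_eqF //.
have /andP[le_x lt_x] : (Num.truncn x^-1)%:R <= x^-1 < (Num.truncn x^-1).+1%:R.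
  by apply: truncn_itv; rewrite invr_ge0 ltW.
by rewrite subr_ge0 le_x ltrBlDl natr1 lt_x.
Qed.

Lemma cylinder_cons a s x : irrational x -> 0 < x < 1 ->
  cylinder (a :: s) x <-> Num.truncn x^-1 = a /\ cylinder s (gauss x).
Proof.
move=> ix /andP[x0 x1]; have x_neq0 : x != 0 by rewrite gt_eqF.
have gx_neq0 : gauss x != 0.
  exact: (irrational_neq_nat 0 (irrational_gauss ix)).
split => [[_ digits]|[ax [_ digits]]].
  have := digits 0%N isT; rewrite cf_digit1 //= => -[ax]; split => //.
  split; first exact: gauss_itv.
  by move=> j js; rewrite -cf_digit_gauss // digits.
split; first by rewrite (ltW x0).
by move=> [|j] js; [rewrite cf_digit1 // ax | rewrite cf_digit_gauss // digits].
Qed.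

Definition between u v x : bool := (u <= x <= v) || (v <= x <= u).

Lemma between_sym u v x : between u v x = between v u x.
Proof. exact: orbC. Qed.

Lemma between_inv_digit a u v x : (0 < a)%N -> 0 <= u -> 0 <= v -> 0 < x ->
  between (a%:R + u)^-1 (a%:R + v)^-1 x = between u v (x^-1 - a%:R).
Proof.
rewrite -(ler1n R) => a1 u0 v0 x0; rewrite /between orbC.
have geE t : 0 <= t -> ((a%:R + t)^-1 <= x) = (x^-1 - a%:R <= t).
  move=> t0; rewrite -[X in _ <= X]invrK lef_pV2 ?posrE ?invr_gt0 //;
    last by lra.
  by rewrite lerBlDl.
have leE t : 0 <= t -> (x <= (a%:R + t)^-1) = (t <= x^-1 - a%:R).
  move=> t0; rewrite -[X in X <= _]invrK lef_pV2 ?posrE ?invr_gt0 //;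
    last by lra.
  by rewrite lerBrDl.
by rewrite !geE // !leE // andbC [X in _ || X]andbC.
Qed.

Lemma between_itv u v x : 0 <= u <= 1 -> 0 <= v <= 1 -> between u v x ->
  0 <= x <= 1.
Proof. by rewrite /between => /andP[? ?] /andP[? ?] /orP[] /andP[? ?]; lra. Qed.

Lemma truncn_between a u v x : irrational x -> 0 <= u <= 1 -> 0 <= v <= 1 ->
  between u v (x - a%:R) -> Num.truncn x = a.
Proof.
move=> ix u01 v01 /(between_itv u01 v01) /andP[x_ge x_le]; apply: truncn_def.
rewrite -subr_ge0 x_ge lt_neqAle (irrational_neq_nat a.+1 ix) /= -natr1; lra.
Qed.

Lemma cylinder_between s x : positive s -> irrational x -> 0 <= x < 1 ->
  cylinder s x <-> between (cf_eval s 0) (cf_eval s 1) x.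
Proof.
have z01 : 0 <= (0 : R) <= 1 by rewrite lexx ler01.
have o01 : 0 <= (1 : R) <= 1 by rewrite lexx ler01.
elim: s x => [|a s IH] x /=.
  move=> _ ix x01; rewrite /between; split => // _.
  by case/andP: x01 => -> /ltW ->.
move=> /andP[a0 s0] ix /andP[x0 x1].
have xgt0 : 0 < x.
  by rewrite lt_neqAle eq_sym x0 andbT (irrational_neq_nat 0 ix).
have u01 := cf_eval_itv s0 z01; have v01 := cf_eval_itv s0 o01.
have IHx := IH _ s0 (irrational_gauss ix) (gauss_itv xgt0).
have gaussE : gauss x = x^-1 - (Num.truncn x^-1)%:R by rewrite /gauss gt_eqF.
have /andP[u0 _] := u01; have /andP[v0 _] := v01.
rewrite between_inv_digit // cylinder_cons ?xgt0 //;
  split => [[ax cyl]|x_between].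
  by rewrite -ax -gaussE; apply/IHx.
have ax := truncn_between (irrationalV ix) u01 v01 x_between.
by split => //; apply/IHx; rewrite gaussE ax.
Qed.

End Irrationals.

Section CylinderMeasure.
Variable R : realType.
Implicit Types (A B : set R) (x u v : R) (s : seq nat).

Lemma countable_rational : countable (@rational R).
Proof. exact: (sub_countable (card_image_le _ _) (countableP _)). Qed.

Lemma measurable_subset_rational A : A `<=` rational -> measurable A.
Proof.
move=> AQ; apply: countable_measurable;
  first by move=> x; exact: measurable_set1.
exact: sub_countable (subset_card_le AQ) countable_rational.
Qed.

Lemma measurable_setD_rational A : measurable (A `\` rational) -> measurable A.
Proof.
move=> mA; rewrite -(setUIDK A rational); apply: measurableU => //.
by apply: measurable_subset_rational; apply: subIsetr.
Qed.

Lemma integral_inv1D u v : 0 <= u -> u < v ->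
  (\int[lebesgue_measure]_(x in `[u, v]) ((1 + x)^-1)%:E)%E =
  (ln (1 + v) - ln (1 + u))%:E.
Proof.
move=> u0 uv.
have d_ln x : 0 <= x -> is_derive x 1 (fun y : R => ln (1 + y)) (1 + x)^-1.
  by move=> x0; apply: is_derive_ln1D; lra.
have c_ln x : 0 <= x -> {for x, continuous (fun y : R => ln (1 + y))}.
  move=> x0; apply: differentiable_continuous; apply/derivable1_diffP.
  exact: (@ex_derive _ _ _ _ _ _ _ (d_ln x x0)).
have c_inv x : 0 <= x -> {for x, continuous (fun y : R => (1 + y)^-1)}.
  move=> x0; apply: cvgV; first by lra.
  by apply: cvgD; [exact: cvg_cst | exact: cvg_id].
rewrite (@continuous_FTC2 _ (fun x => (1 + x)^-1) (fun x => ln (1 + x))) //.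
- apply: continuous_in_subspaceT => x; rewrite inE /= in_itv /= => /andP[ux _].
  by apply: c_inv; lra.
- split.
  + move=> x; rewrite in_itv /= => /andP[ux _].
    by apply: ex_derive; apply: d_ln; lra.
  + by apply: cvg_at_right_filter; apply: c_ln.
  + by apply: cvg_at_left_filter; apply: c_ln; lra.
- move=> x; rewrite in_itv /= => /andP[ux _]; rewrite derive1E.
  by have x0 : 0 <= x; [lra | rewrite (derive_val (is_derive := d_ln x x0))].
Qed.

Lemma measurable_fun_inv1D :
  measurable_fun (`[(0 : R), 1]%classic) (fun x : R => (1 + x)^-1).
Proof.
apply: subspace_continuous_measurable_fun => //.
apply: continuous_in_subspaceT => x; rewrite inE /= in_itv /= => /andP[x0 _].
apply: cvgV; first by lra.
by apply: cvgD; [exact: cvg_cst | exact: cvg_id].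
Qed.

Lemma gauss_measure_setD_rational A : measurable A -> A `<=` `[(0 : R), 1] ->
  gauss_measure (A `\` rational) = gauss_measure A.
Proof.
move=> mA A01; rewrite /gauss_measure; congr (_ * fine _); apply/esym.
apply: ge0_negligible_integral => //.
- by apply: measurable_subset_rational.
- apply/measurable_EFinP.
  by apply: measurable_funS A01 measurable_fun_inv1D => //;
    exact: measurable_itv.
- by move=> x /A01; rewrite /= in_itv /= => /andP[x0 _];
  rewrite lee_fin invr_ge0; lra.
- exact: lebesgue_measure_rat.
Qed.

Lemma gauss_measure_itv u v : 0 <= u -> u < v ->
  gauss_measure `[u, v] = (ln (1 + v) - ln (1 + u)) / ln 2.
Proof. by move=> u0 uv; rewrite /gauss_measure integral_inv1D //= mulrC. Qed.

Lemma set_between u v : u <= v -> [set x | between u v x] = `[u, v]%classic.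
Proof.
move=> uv; rewrite set_itvcc; apply/seteqP; split=> x /=; rewrite /between.
  by move=> /orP[//|/andP[? ?]]; lra.
by move=> ->.
Qed.

Lemma measurable_between u v : measurable [set x | between u v x].
Proof.
have [uv|/ltW vu] := leP u v;
  first by rewrite set_between //; apply: measurable_itv.
rewrite (_ : [set x | _] = [set x | between v u x]).
  by rewrite set_between //; apply: measurable_itv.
by apply/funext => x /=; rewrite between_sym.
Qed.

Lemma gauss_measure_between u v : 0 <= u -> 0 <= v -> u != v ->
  gauss_measure [set x | between u v x] = `|ln (1 + v) - ln (1 + u)| / ln 2.
Proof.
wlog uv : u v / u < v => [lt_case u0 v0 uv|u0 v0 _].
  case: (ltgtP u v) uv => // [uv|vu] _;
    first by apply: lt_case => //; rewrite lt_eqF.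
  rewrite distrC -lt_case ?lt_eqF //.
  by congr gauss_measure; apply/funext => x /=; rewrite between_sym.
rewrite set_between ?ltW // gauss_measure_itv // ger0_norm // subr_ge0.
by rewrite ler_ln ?posrE; lra.
Qed.

Lemma cylinder_setD_rational s : positive s ->
  cylinder s `\` rational =
  [set x | between (cf_eval s 0) (cf_eval s 1) x] `\` @rational R.
Proof.
move=> s0; have z01 : 0 <= (0 : R) <= 1 by rewrite lexx ler01.
have o01 : 0 <= (1 : R) <= 1 by rewrite lexx ler01.
apply/seteqP; split => x [] sx ix; split => //.
  by apply/(cylinder_between s0 ix); case: sx.
have /andP[x0 x1] := between_itv (cf_eval_itv s0 z01) (cf_eval_itv s0 o01) sx.
apply/(cylinder_between s0 ix) => //.
by rewrite x0 lt_neqAle (irrational_neq_nat 1 ix).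
Qed.

Lemma cf_eval_inj s : injective (@cf_eval R s).
Proof. by elim: s => // a s IH x y /= /invr_inj /addrI /IH. Qed.

Lemma normr_gauss_mass s : positive s ->
  gauss_mass R s = `|ln (1 + cf_eval s 1) - ln (1 + cf_eval s 0)| / ln 2.
Proof.
move=> s0; have /andP[mass0 _] := gauss_mass_itv R s0.
rewrite -[LHS]ger0_norm // /gauss_mass !normrM normr_sign mul1r.
by rewrite [`|_^-1|]gtr0_norm // invr_gt0 ln2_gt0.
Qed.

Lemma gauss_measure_cylinder s : positive s ->
  gauss_measure (cylinder s) = gauss_mass R s.
Proof.
move=> s0; have z01 : 0 <= (0 : R) <= 1 by rewrite lexx ler01.
have o01 : 0 <= (1 : R) <= 1 by rewrite lexx ler01.
have u01 := cf_eval_itv s0 z01; have v01 := cf_eval_itv s0 o01.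
have /andP[u0 _] := u01; have /andP[v0 _] := v01.
pose I : set R := [set x | between (cf_eval s 0) (cf_eval s 1) x].
have mI : measurable I by apply: measurable_between.
have I01 : I `<=` `[(0 : R), 1].
  by move=> x /(between_itv u01 v01); rewrite /= in_itv.
have C01 : cylinder s `<=` `[(0 : R), 1].
  by move=> x [/andP[x0 /ltW x1] _]; rewrite /= in_itv /= x0.
have mC : measurable (cylinder s : set R).
  apply: measurable_setD_rational; rewrite cylinder_setD_rational //.
  by apply: measurableD => //; apply: measurable_subset_rational.
rewrite -gauss_measure_setD_rational // cylinder_setD_rational //.
rewrite gauss_measure_setD_rational // gauss_measure_between
  ?normr_gauss_mass //.
by rewrite (inj_eq (@cf_eval_inj s)) eq_sym oner_eq0.
Qed.

Lemma gauss_mass_nil : gauss_mass R [::] = 1.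
Proof.
by rewrite /gauss_mass mul1r /= addr0 ln1 subr0 -[1 + 1]/2 divff // gt_eqF //
  ln2_gt0.
Qed.

End CylinderMeasure.

(** * Existence of the number *)

Section Existence.
Variable R : realType.
Implicit Types (x y : R) (w : seq nat) (d : nat -> nat).

Lemma normr_cf_evalB w x y : positive w -> 0 <= x <= 1 -> 0 <= y <= 1 ->
  `|cf_eval w x - cf_eval w y| = `|x - y| * (cf_tails w x * cf_tails w y).
Proof.
move=> + x01 y01; elim: w => [|a w IH]; first by rewrite !cf_tails_nil !mulr1.
move=> /= /andP[a0 w0]; rewrite !cf_tails_cons /=.
have a1 : 1 <= a%:R :> R by rewrite ler1n.
have /andP[u0 _] := cf_eval_itv w0 x01; have /andP[v0 _] := cf_eval_itv w0 y01.
rewrite normr_invB; [|lra|lra]; rewrite opprD addrACA subrr add0r IH //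
  invfM; ring.
Qed.

Lemma normr_cf_evalB_le w x y : positive w -> 0 <= x <= 1 -> 0 <= y <= 1 ->
  `|cf_eval w x - cf_eval w y| <= 2 * 2^-1 ^+ size w.
Proof.
move=> w0 x01 y01; rewrite normr_cf_evalB //.
have xy : `|x - y| <= 1.
  move: x01 y01 => /andP[? ?] /andP[? ?]; rewrite ler_norml.
  by apply/andP; split; lra.
have := sqr_cf_tails_le w0 x01; have := sqr_cf_tails_le w0 y01.
have := cf_tails_gt0 w0 x01; have := cf_tails_gt0 w0 y01.
set p := cf_tails w x; set q := cf_tails w y => q0 p0 q_le p_le.
apply: (@le_trans _ _ (p * q)); first by rewrite ler_piMl // mulr_ge0 ?ltW.
by have := sqr_ge0 (p - q); rewrite sqrrB; lra.
Qed.

Definition cf_convergent d n : R := cf_eval (mkseq d n) 0.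

Definition cf_value d : R := limn (cf_convergent d).

Lemma positive_mkseq d n i : (forall i, 0 < d i)%N ->
  positive [seq d j | j <- iota i n].
Proof. by move=> d0; apply/allP => a /mapP[j _ ->]. Qed.

Lemma cf_convergent_itv d n : (forall i, 0 < d i)%N ->
  0 <= cf_convergent d n <= 1.
Proof.
by move=> d0; apply: cf_eval_itv; rewrite ?positive_mkseq ?lexx ?ler01.
Qed.

Lemma cf_convergentS d n :
  cf_convergent d n.+1 = ((d 0%N)%:R + cf_convergent (d \o succn) n)^-1.
Proof. by rewrite /cf_convergent /mkseq /= -[1%N]addn0 iotaDl -map_comp. Qed.

Lemma normr_cf_convergentB_le d n m : (forall i, 0 < d i)%N -> (n <= m)%N ->
  `|cf_convergent d n - cf_convergent d m| <= 2 * 2^-1 ^+ n.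
Proof.
move=> d0 nm; rewrite /cf_convergent -(subnKC nm) /mkseq iotaD map_cat
  cf_eval_cat.
have := @normr_cf_evalB_le (mkseq d n) 0
  (cf_eval [seq d i | i <- iota n (m - n)] 0).
by rewrite size_mkseq; apply; rewrite ?cf_eval_itv ?positive_mkseq ?lexx ?ler01.
Qed.

Lemma is_cvg_cf_convergent d : (forall i, 0 < d i)%N -> cvgn (cf_convergent d).
Proof.
move=> d0; apply/cauchy_cvgP/cauchy_exP => e e0.
have half1 : `|2^-1| < 1 :> R by rewrite ger0_norm; lra.
have /filter_ex[n small] := near_geometric_lt 2 half1 e0.
exists (cf_convergent d n); exists n => // m /= nm.
by rewrite -ball_normE /=; apply: le_lt_trans small;
  apply: normr_cf_convergentB_le.
Qed.

Lemma cf_value_itv d : (forall i, 0 < d i)%N -> 0 <= cf_value d <= 1.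
Proof.
move=> d0; have d_cvg := is_cvg_cf_convergent d0.
have conv01 n := cf_convergent_itv n d0.
apply/andP; split; [apply: limr_ge | apply: limr_le] => //; apply: nearW => n.
  by case/andP: (conv01 n).
by case/andP: (conv01 n).
Qed.

Lemma cf_value_recl d : (forall i, 0 < d i)%N ->
  cf_value d = ((d 0%N)%:R + cf_value (d \o succn))^-1.
Proof.
move=> d0; have d'0 i : (0 < (d \o succn) i)%N by apply: d0.
have : cf_convergent d n.+1 @[n --> \oo] --> cf_value d.
  by rewrite cvg_shiftS; apply: is_cvg_cf_convergent.
have : cf_convergent d n.+1 @[n --> \oo] -->
    ((d 0%N)%:R + cf_value (d \o succn))^-1.
  under eq_fun => n do rewrite cf_convergentS.
  apply: cvgV;
    last by apply: cvgD; [exact: cvg_cst | exact: is_cvg_cf_convergent].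
  by rewrite gt_eqF // ltr_wpDr ?ltr0n //; case/andP: (cf_value_itv d'0).
by move=> /(cvg_lim (@Rhausdorff R)) <- /(cvg_lim (@Rhausdorff R)) <-.
Qed.

Lemma cf_value_gt0 d : (forall i, 0 < d i)%N -> 0 < cf_value d.
Proof.
move=> d0; rewrite cf_value_recl // invr_gt0 ltr_wpDr ?ltr0n //.
by case/andP: (@cf_value_itv (d \o succn) (fun i => d0 i.+1)).
Qed.

Lemma cf_value_lt1 d : (forall i, 0 < d i)%N -> cf_value d < 1.
Proof.
move=> d0; have tail0 := @cf_value_gt0 (d \o succn) (fun i => d0 i.+1).
have a1 : 1 <= (d 0%N)%:R :> R by rewrite ler1n.
by rewrite cf_value_recl // invf_lt1; lra.
Qed.

Lemma truncn_cf_valueV d : (forall i, 0 < d i)%N ->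
  Num.truncn (cf_value d)^-1 = d 0%N.
Proof.
move=> d0; rewrite cf_value_recl // invrK; apply: truncn_def.
have := @cf_value_gt0 (d \o succn) (fun i => d0 i.+1).
have := @cf_value_lt1 (d \o succn) (fun i => d0 i.+1).
by rewrite -natr1 => tail1 tail0; apply/andP; split; lra.
Qed.

Lemma gauss_cf_value d : (forall i, 0 < d i)%N ->
  gauss (cf_value d) = cf_value (d \o succn).
Proof.
move=> d0; rewrite /gauss gt_eqF ?cf_value_gt0 // truncn_cf_valueV //
  cf_value_recl // invrK.
by rewrite addrAC subrr add0r.
Qed.

Lemma gauss_orbit_cf_value d i : (forall i, 0 < d i)%N ->
  gauss_orbit (cf_value d) i = cf_value (fun j => d (i + j)%N).
Proof.
move=> d0; elim: i => [|i IH] //.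
rewrite /gauss_orbit iterS -/(gauss_orbit _ _) IH.
rewrite gauss_cf_value //; congr cf_value.
by apply/funext => j /=; rewrite addnS.
Qed.

Lemma has_cf_cf_value d : (forall i, 0 < d i)%N -> has_cf (cf_value d) d.
Proof.
move=> d0; split; first by rewrite ltW ?cf_value_gt0 ?cf_value_lt1.
move=> i; rewrite /cf_digit gauss_orbit_cf_value //.
have tail0 (j : nat) : (0 < d (i + j))%N by [].
rewrite gt_eqF ?cf_value_gt0 //= gauss_cf_value // gt_eqF.
  by rewrite (truncn_cf_valueV tail0) addn0.
by apply: cf_value_gt0 => j; apply: tail0.
Qed.

Lemma exists_concat k : exists2 d, is_concat R k d & forall i, (0 < d i)%N.
Proof.
pose Q i := ex_minn (concat_prefix_unbounded R k i).
have iQ i : (i < size (concat_prefix R k (Q i)))%N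
  by rewrite /Q; case: ex_minnP.
exists (fun i => nth 0%N (concat_prefix R k (Q i)) i) => [Q' i iQ'|i].
  rewrite !concat_prefixE in iQ' *; have := iQ i; rewrite concat_prefixE.
  have [/(rat_words_prefix R k)|/ltnW/(rat_words_prefix R k)] := leqP (Q i) Q'.
    by move=> [l ->]; rewrite flatten_cat nth_cat => ->.
  by move=> [l ->]; rewrite flatten_cat nth_cat iQ'.
have := mem_nth 0%N (iQ i); rewrite {2}concat_prefixE.
by move=> /flattenP[w /mem_rat_words[/andP[w0 _] _] /(allP w0)].
Qed.

End Existence.

Theorem theorem1p4 (R : realType) (k : subseq_kind) :
  (exists (d : nat -> nat) (x : R), is_concat R k d /\ has_cf x d) /\
  (forall (d : nat -> nat) (x : R), is_concat R k d -> has_cf x d -> cf_normal x).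
Proof.
split.
  have [d dc d0] := exists_concat R k.
  by exists d, (cf_value R d); split => //; apply: has_cf_cf_value.
move=> d x dc dx s s0 /=; rewrite gauss_measure_cylinder //.
case: s s0 => [_|a s s0]; last exact: occ_cvg dc dx _ s0.
rewrite gauss_mass_nil; apply: cvg_near_cst; exists 1%N => // N /= N1.
rewrite /occ (eq_count (a2 := predT)) // count_predT size_iota divff //.
by rewrite pnatr_eq0 -lt0n.
Qed.
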